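(* Let $G$ be a finitely generated torsion free nilpotent group. Then $G$ is co-Hopfian if and only if $|\det(\Phi)|=1$ for every Lie algebra automorphism $\Phi$ of $L(G)$ that maps $\log(G)$ into itself (i.e. $\Phi(\log(G))\subseteq \log(G)$).
   Context: A group is co-Hopfian if it contains no proper subgroup isomorphic to itself. By Mal'cev, any finitely generated torsion free nilpotent group $G$ is isomorphic to a cocompact discrete subgroup of a simply-connected nilpotent Lie group $N_G$, which is unique up to isomorphism; we regard $G$ as a subgroup of $N_G$. The exponential map $\exp$ from the Lie algebra $L(N_G)$ of $N_G$ to $N_G$ is a diffeomorphism with globally defined inverse $\log$. The $\mathbb{Q}$-span of $\log(G)$ is a finite-dimensional nilpotent Lie algebra over $\mathbb{Q}$, denoted $L(G)$. Automorphisms of $L(G)$ are automorphisms of Lie algebras over $\mathbb{Q}$, and $\det(\Phi)$ is the determinant of $\Phi$ as a $\mathbb{Q}$-linear map of $L(G)$. *)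

(* Defs.v *)
From HB Require Import structures.
From mathcomp Require Import all_boot all_order all_fingroup all_algebra.
From mathcomp Require Import all_classical all_reals all_analysis.

Set Implicit Arguments.
Unset Strict Implicit.
Unset Printing Implicit Defensive.

Import Order.TTheory GRing.Theory Num.Theory numFieldNormedType.Exports.

Local Open Scope classical_set_scope.
Local Open Scope ring_scope.

Section AbstractGroups.
Variable G : groupType.
Local Open Scope group_scope.

Definition subgroup (H : set G) : Prop :=
  [/\ H 1, (forall x y, H x -> H y -> H (x * y)) & (forall x, H x -> H x^-1)].

Definition generated (A : set G) : set G :=
  [set x | forall H : set G, subgroup H -> A `<=` H -> H x].

Definition finitely_generated : Prop :=
  exists s : seq G, generated [set` s] = [set: G].

Definition torsion_free : Prop :=
  forall (x : G) (k : nat), (0 < k)%N -> x ^+ k = 1 -> x = 1.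

(* [lower_central k] is usually written gamma_(k+1). *)
Fixpoint lower_central (k : nat) : set G :=
  if k is k'.+1 then
    generated [set z | exists x y : G, lower_central k' x /\ z = [~ x, y]]
  else [set: G].

Definition nilpotent_group : Prop := exists k, lower_central k = [set 1].

Definition co_Hopfian : Prop :=
  forall H : set G, subgroup H ->
    (exists f : G -> G,
       {morph f : x y / x * y >-> x * y} /\ set_bij [set: G] H f) ->
    H = [set: G].

End AbstractGroups.

(* All iterated directional derivatives exist and are Frechet differentiable,
   i.e. f is of class C^oo. *)
Definition smooth (R : realType) (V W : normedModType R) (f : V -> W) : Prop :=
  forall (vs : seq V) (x : V),
    differentiable (foldr (fun v (g : V -> W) => fun y => 'D_v g y) f vs) x.

(* A Lie group whose underlying manifold is diffeomorphic to R^n, presented by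
   a global chart.  A simply connected nilpotent Lie group is diffeomorphic to
   its Lie algebra (by exp), and conversely R^n is simply connected; so the
   simply connected nilpotent Lie groups are exactly the [lieGroup R n] whose
   underlying group is nilpotent. *)
Record lieGroup (R : realType) (n : nat) := LieGroup {
  lie_sort :> groupType ;
  chart : lie_sort -> 'rV[R]_n ;
  unchart : 'rV[R]_n -> lie_sort ;
  chartK : cancel chart unchart ;
  unchartK : cancel unchart chart ;
  smooth_mul : smooth (fun p : 'rV[R]_n * 'rV[R]_n =>
                         chart (unchart p.1 * unchart p.2)%g) ;
  smooth_inv : smooth (fun p : 'rV[R]_n => chart (unchart p)^-1%g)
}.

Section LieGroups.
Variables (R : realType) (n : nat) (N : lieGroup R n).
Local Notation V := 'rV[R]_n.

Definition lie_open (U : set N) : Prop := open [set p : V | U (unchart N p)].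

Definition discrete_subset (H : set N) : Prop :=
  forall h, H h -> exists U : set N, [/\ lie_open U, U h & U `&` H = [set h]].

(* Compactness of the coset space N / H: its open sets are the open subsets of N
   that are stable under right translation by H. *)
Definition cocompact (H : set N) : Prop :=
  forall C : set (set N),
    (forall U, C U ->
       lie_open U /\ (forall x h, U x -> H h -> U (x * h)%g)) ->
    \bigcup_(U in C) U = [set: N] ->
    exists D : set (set N),
      [/\ finite_set D, D `<=` C & \bigcup_(U in D) U = [set: N]].

(* The Lie algebra of N is its tangent space at 1, identified with R^n through
   the chart. Ad x is the differential at 1 of y |-> x y x^-1, and the bracket
   is [X, Y] = ad X Y where ad is the differential of Ad at 1. *)
Definition Ad (x : N) (Y : V) : V :=
  'D_Y (fun q : V => chart (x * unchart N q * x^-1)%g) (chart (1%g : N)).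

Definition lie_bracket (X Y : V) : V :=
  'D_X (fun p : V => Ad (unchart N p) Y) (chart (1%g : N)).

(* t |-> exp (t X) is the one-parameter subgroup with initial velocity X. *)
Definition is_exp (exp : V -> N) : Prop :=
  forall X : V,
    (forall s t : R,
     exp ((s + t) *: X) = (exp (s *: X)%R * exp (t *: X)%R)%g) /\
    is_derive (0 : R) (1 : R) (fun t : R => chart (exp (t *: X))) X.

Definition is_exp_log (exp : V -> N) (log : N -> V) : Prop :=
  [/\ is_exp exp, cancel exp log, cancel log exp,
      smooth (fun X : V => chart (exp X)) &
      smooth (fun p : V => log (unchart N p))].

End LieGroups.

Section RationalSpan.
Variables (R : realType) (V : lmodType R).

Definition Qspan (A : set V) : set V :=
  [set v | exists (d : nat) (a : 'I_d -> V) (c : 'I_d -> rat),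
     (forall i, A (a i)) /\ v = \sum_(i < d) ratr (c i) *: a i].

Definition Qbasis (L : set V) (d : nat) (b : 'I_d -> V) : Prop :=
  (forall c : 'I_d -> rat,
     \sum_(i < d) ratr (c i) *: b i = 0 -> forall i, c i = 0) /\
  Qspan (range b) = L.

(* Determinant of the Q-linear map Phi : L -> L, L finite-dimensional over Q,
   computed in some Q-basis of L; it is 0 by convention if there is none. *)
Definition Qdet (L : set V) (Phi : V -> V) : rat :=
  xget 0 [set D | exists (d : nat) (b : 'I_d -> V) (M : 'M[rat]_d),
    [/\ Qbasis L b,
        forall i, Phi (b i) = \sum_(j < d) ratr (M i j) *: b j &
        D = \det M]].

(* Lie algebra automorphisms over Q of the Q-subspace L; the values of Phi
   outside L are irrelevant. *)
Definition Qlie_automorphism (br : V -> V -> V) (L : set V) (Phi : V -> V) :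
    Prop :=
  [/\ set_bij L L Phi,
      forall X Y, L X -> L Y -> Phi (X + Y) = Phi X + Phi Y,
      forall (c : rat) X, L X -> Phi (ratr c *: X) = ratr c *: Phi X &
      forall X Y, L X -> L Y -> Phi (br X Y) = br (Phi X) (Phi Y)].

End RationalSpan.

(* Main.v *)
(* In exponential coordinates the group law is the Baker-Campbell-Hausdorff series,
   a finite rational combination of bracket words. By induction on the weight of
   brackets, [log G] contains all sufficiently divisible elements of any finitely
   generated additive subgroup of [L(G)]; conversely, as [G] is finitely generated,
   [log G] is contained in a finitely generated additive subgroup of [L(G)].

   Automorphisms of [L(G)] preserving [log G] are the same as injective endomorphisms
   of [G]: an automorphism respects the Baker-Campbell-Hausdorff series, and the
   rational span of the graph of an injective endomorphism is the graph of an
   automorphism. It remains to see that [Phi] maps [log G] onto [log G] if and only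
   if [|det Phi| = 1]. All the powers of the matrix of [Phi] have a common
   denominator, so [det Phi] is an integer; the same holds for the inverse of [Phi]
   when [Phi] is onto. If [|det Phi| = 1], the iterated preimages of [y] in [log G]
   lie in a lattice, hence in finitely many cosets of [G], and this forces [y] to be
   in the image of [Phi]. *)

Require Import Defs.
From HB Require Import structures.
From mathcomp Require Import all_boot all_order all_fingroup all_algebra.
From mathcomp Require Import all_classical all_reals all_analysis.
From mathcomp Require Import zify ring.
Import Order.TTheory GRing.Theory Num.Theory numFieldNormedType.Exports.
Local Open Scope classical_set_scope.
Local Open Scope ring_scope.

Set Implicit Arguments.
Unset Strict Implicit.
Unset Printing Implicit Defensive.

(** * Brackets and groups satisfying a Baker-Campbell-Hausdorff formula *)

(** The Baker-Campbell-Hausdorff formula is itself derived from the smooth group law, and everything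
    about $G$ then rests on the record [bch_law] alone. In exponential coordinates conjugation by
    $x$ commutes with real scalars, hence is linear; Taylor expansion along one-parameter subgroups
    gives $Ad(\exp x) = e^{ad x}$, then the differential of $\exp$, then a differential equation for
    $\exp(tx)\exp(y)$ whose solution is a finite combination of bracket words with rational
    coefficients. The words are kept as syntax, independent of the vector space, so that one and the
    same list [s] also describes the product law on [V * V]. There the graph of an endomorphism of
    $G$ is a subgroup, to which all results on subgroups apply. The main obstacle is that $\log G$
    is in general not closed under addition, so that its image under $\Phi$ cannot be measured as an
    index of lattices. It is only squeezed between two lattices; all iterates of $\Phi$ are
    therefore used at once, with a denominator that does not depend on the iterate. *)

Inductive btree := LX | LY | Br of btree & btree.

HB.instance Definition _ := gen_eqMixin btree.

Definition isBr (w : btree) : bool := if w is Br _ _ then true else false.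

Section Bracket.
Variables (R : numFieldType) (V : lmodType R).

Fixpoint ev (br : V -> V -> V) (w : btree) (x y : V) : V :=
  match w with
  | LX => x
  | LY => y
  | Br u v => br (ev br u x y) (ev br v x y)
  end.

Definition evs (br : V -> V -> V) (s : seq (rat * btree)) (x y : V) : V :=
  \sum_(p <- s) ratr p.1 *: ev br p.2 x y.

(** [br_nil] speaks of right-nested words only; [bracket_deep] brings other parenthesizations to
    this form, at the price of the bound [2 ^ c] on the weight. *)
Record nil_bracket (br : V -> V -> V) (c : nat) : Prop := NilBracket {
  brDl : forall x x' y, br (x + x') y = br x y + br x' y;
  brDr : forall x y y', br x (y + y') = br x y + br x y';
  brZl : forall q x y, br (ratr q *: x) y = ratr q *: br x y;
  brZr : forall q x y, br x (ratr q *: y) = ratr q *: br x y;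
  brxx : forall x, br x x = 0;
  br_nil : forall xs y, size xs = c -> foldr br y xs = 0
}.

(* The words in [s] are unspecified: it is [bch_conj] that identifies the leading
   term of a group commutator as the bracket. *)
Record bch_law (br : V -> V -> V) (c : nat) (op : V -> V -> V)
    (s : seq (rat * btree)) : Prop := BchLaw {
  bch_br : nil_bracket br c;
  bch_isBr : all (fun p => isBr p.2) s;
  bch_op : forall x y, op x y = x + y + evs br s x y;
  bch_opA : associative op;
  bch_conj : forall x y, op (op x y) (- x) =
    \sum_(j < c.+2) ratr (j`!%:R^-1) *: iter j (br x) y
}.

Inductive bracket_of (br : V -> V -> V) (A : set V) : nat -> V -> Prop :=
| bracket_leaf x : A x -> bracket_of br A 1 x
| bracket_br i j x y : bracket_of br A i x -> bracket_of br A j y ->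
    bracket_of br A (i + j) (br x y).

(* The rational coefficient is kept apart from the integer-valued function [p], so
   that divisibility properties of [p] can be used to clear denominators. *)
Inductive combo (br : V -> V -> V) (A : set V) (T : Type)
    (P : (T -> int) -> Prop) (i : nat) : (T -> V) -> Prop :=
| combo0 : combo br A P i (fun=> 0)
| comboD U U' : combo br A P i U -> combo br A P i U' ->
    combo br A P i (fun t => U t + U' t)
| combo_gen p q j v : P p -> (i <= j)%N -> bracket_of br A j v ->
    combo br A P i (fun t => ratr q *: (v *~ p t)).

End Bracket.

(** Closure under multiplication by arbitrary functions lets a bracket inherit divisibility from
    just one of its arguments. The instances are [anyp] and [divp]. *)
Definition ideal (T : Type) (P : (T -> int) -> Prop) : Prop :=
  forall p p', P p -> P (fun t => p' t * p t).

Definition anyp (T : Type) (p : T -> int) : Prop := True.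

Section BracketTheory.
Variables (R : numFieldType) (V : lmodType R) (br : V -> V -> V) (c : nat).
Hypothesis Hbr : nil_bracket br c.

Lemma br0r x : br x 0 = 0.
Proof. by have := brZr Hbr 0 x 0; rewrite rmorph0 !scale0r. Qed.

Lemma br0l x : br 0 x = 0.
Proof. by have := brZl Hbr 0 0 x; rewrite rmorph0 !scale0r. Qed.

Lemma brNr x y : br x (- y) = - br x y.
Proof. by apply/eqP; rewrite -addr_eq0 -(brDr Hbr) addNr br0r. Qed.

Lemma brNl x y : br (- x) y = - br x y.
Proof. by apply/eqP; rewrite -addr_eq0 -(brDl Hbr) addNr br0l. Qed.

Lemma br_anti x y : br x y = - br y x.
Proof.
apply/eqP; rewrite -addr_eq0; apply/eqP.
by have := brxx Hbr (x + y); rewrite (brDl Hbr) !(brDr Hbr) !(brxx Hbr) addr0 add0r.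
Qed.

Lemma brMzl x y n : br (x *~ n) y = br x y *~ n.
Proof.
by have := brZl Hbr n%:~R x y; rewrite ratr_int !scaler_int.
Qed.

Lemma brMzr x y n : br x (y *~ n) = br x y *~ n.
Proof.
by have := brZr Hbr n%:~R x y; rewrite ratr_int !scaler_int.
Qed.

Lemma bracket_of_gt0 A j v : bracket_of br A j v -> (0 < j)%N.
Proof. by elim=> // i k x y _ Hi _ _; rewrite ltn_addr. Qed.

(* A word with more than [2 ^ k] leaves is deeper than [k], however it is
   parenthesized, and antisymmetry then nests its deepest branch to the right. *)
Lemma bracket_deep A j v k : bracket_of br A j v -> (2 ^ k < j)%N ->
  exists xs y, size xs = k.+1 /\ v = foldr br y xs.
Proof.
move=> H; elim: H k => {j v} [x _ k|i j x y _ IHx _ IHy [|k]].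
- by have := expn_gt0 2 k; lia.
- by move=> _; exists [:: x], y.
rewrite expnS => Hk; have [/IHx|Hi] := ltnP (2 ^ k) i.
  move=> [xs [y' [sxs ->]]]; exists (- y :: xs), y'.
  by rewrite /= sxs brNl -br_anti.
have /IHy [xs [y' [sxs ->]]] : (2 ^ k < j)%N by lia.
by exists (x :: xs), y'; rewrite /= sxs.
Qed.

Lemma bracket_nil A j v : bracket_of br A j v -> (2 ^ c < j)%N -> v = 0.
Proof.
move=> /bracket_deep H /H [[|x xs] [y [//= [sxs] ->]]].
by rewrite (br_nil Hbr) // br0r.
Qed.

Section Combo.
Variable A : set V.

Lemma combo_scale (T : Type) (P : (T -> int) -> Prop) i q U :
  combo br A P i U -> combo br A P i (fun t => ratr q *: U t).
Proof.
elim=> [|{}U U' _ IH _ IH'|p q' j v Pp ij Hv].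
- have -> : (fun t => ratr q *: 0) = (fun=> 0 : V) :> (T -> V).
    by apply/funext => t; rewrite scaler0.
  exact: combo0.
- have -> : (fun t => ratr q *: (U t + U' t)) =
    (fun t => ratr q *: U t + ratr q *: U' t).
    by apply/funext => t; rewrite scalerDr.
  exact: comboD.
under eq_fun do rewrite scalerA -rmorphM.
exact: combo_gen Hv.
Qed.

Lemma comboN (T : Type) (P : (T -> int) -> Prop) i U :
  combo br A P i U -> combo br A P i (fun t => - U t).
Proof.
move=> /(combo_scale (-1)); congr combo.
by apply/funext => t; rewrite rmorphN1 scaleN1r.
Qed.

Lemma comboB (T : Type) (P : (T -> int) -> Prop) i U U' :
  combo br A P i U -> combo br A P i U' -> combo br A P i (fun t => U t - U' t).
Proof. by move=> HU /comboN HU'; exact: comboD. Qed.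

Lemma combo_sum (T : Type) (P : (T -> int) -> Prop) i (I : Type) (r : seq I)
    (Q : pred I) (F : I -> T -> V) :
  (forall k, Q k -> combo br A P i (F k)) ->
  combo br A P i (fun t => \sum_(k <- r | Q k) F k t).
Proof.
move=> HF; elim: r => [|k r IH].
  have -> : (fun t => \sum_(k <- [::] | Q k) F k t) = (fun=> 0).
    by apply/funext => t; rewrite big_nil.
  exact: combo0.
have -> : (fun t => \sum_(k <- k :: r | Q k) F k t) =
    (fun t => (if Q k then F k t else 0) + \sum_(k <- r | Q k) F k t).
  by apply/funext => t; rewrite big_cons; case: ifP => // _; rewrite add0r.
by apply: comboD => //; case Qk: (Q k); [exact: HF|exact: combo0].
Qed.

Lemma combo_weak (T : Type) (P P' : (T -> int) -> Prop) i i' U :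
  (forall p, P p -> P' p) -> (i' <= i)%N ->
  combo br A P i U -> combo br A P' i' U.
Proof.
move=> PP' ii'; elim=> [|{}U U' _ IH _ IH'|p q j v Pp ij Hv].
- exact: combo0.
- exact: comboD.
- by apply: (combo_gen _ _ _ Hv) => //; [exact: PP'|exact: leq_trans ij].
Qed.

Lemma combo_weight (T : Type) (P : (T -> int) -> Prop) i i' U :
  (i' <= i)%N -> combo br A P i U -> combo br A P i' U.
Proof. exact: combo_weak. Qed.

Lemma combo_any (T : Type) (P : (T -> int) -> Prop) i U :
  combo br A P i U -> combo br A (@anyp T) i U.
Proof. exact: combo_weak. Qed.

Lemma combo_brr (T : Type) (P : (T -> int) -> Prop) i j U U' : ideal P ->
  combo br A (@anyp T) i U -> combo br A P j U' ->
  combo br A P (i + j) (fun t => br (U t) (U' t)).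
Proof.
move=> idP HU HU'; elim: HU => [|U1 U2 _ IH1 _ IH2|p q i' v _ ii' Hv].
- have -> : (fun t => br 0 (U' t)) = (fun=> 0) by apply/funext => t; rewrite br0l.
  exact: combo0.
- have -> : (fun t => br (U1 t + U2 t) (U' t)) =
     (fun t => br (U1 t) (U' t) + br (U2 t) (U' t)).
    by apply/funext => t; rewrite (brDl Hbr).
  exact: comboD.
elim: HU' => [|U1 U2 _ IH1 _ IH2|p' q' j' v' Pp' jj' Hv'].
- have -> : (fun t => br (ratr q *: (v *~ p t)) 0) = (fun=> 0).
    by apply/funext => t; rewrite br0r.
  exact: combo0.
- under eq_fun do rewrite (brDr Hbr).
  exact: comboD.
under eq_fun do
  rewrite (brZl Hbr) (brZr Hbr) scalerA -rmorphM brMzl brMzr -mulrzA mulrC.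
apply: combo_gen; [|exact: leq_add ii' jj'|exact: bracket_br].
by under eq_fun do rewrite mulrC; exact: idP.
Qed.

Lemma combo_brl (T : Type) (P : (T -> int) -> Prop) i j U U' : ideal P ->
  combo br A P i U -> combo br A (@anyp T) j U' ->
  combo br A P (i + j) (fun t => br (U t) (U' t)).
Proof.
move=> idP HU HU'; under eq_fun do rewrite br_anti.
by rewrite addnC; apply/comboN/combo_brr.
Qed.

Lemma combo_large (T : Type) (P : (T -> int) -> Prop) i U :
  (2 ^ c < i)%N -> combo br A P i U -> U = (fun=> 0).
Proof.
move=> ci; elim=> [//|{}U U' _ -> _ ->|p q j v Pp ij Hv]; apply/funext => t.
  by rewrite addr0.
by rewrite (bracket_nil Hv) ?(leq_trans ci) // mul0rz scaler0.
Qed.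

Lemma combo_comp (T T' : Type) (P : (T -> int) -> Prop) (P' : (T' -> int) -> Prop)
    (f : T' -> T) i U :
  (forall p, P p -> P' (p \o f)) ->
  combo br A P i U -> combo br A P' i (U \o f).
Proof.
move=> Pf; elim=> [|{}U U' _ IH _ IH'|p q j v Pp ij Hv].
- exact: combo0.
- exact: comboD IH IH'.
- by apply: (combo_gen (p := p \o f) _ _ ij Hv) => //; exact: Pf.
Qed.

(** With a one-point parameter space, [combo] gives the descending filtration by bracket weight. *)
Definition wspan (i : nat) (v : V) := combo br A (@anyp unit) i (fun=> v).

Lemma ideal_any T : ideal (@anyp T). Proof. by []. Qed.

Lemma combo_const (T : Type) (P : (T -> int) -> Prop) i v p : ideal P -> P p ->
  wspan i v -> combo br A P i (fun t => v *~ p t).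
Proof.
rewrite /wspan => idP Pp.
suff H U : combo br A (@anyp unit) i U -> combo br A P i (fun t => U tt *~ p t).
  by move=> /H.
elim=> [|{}U U' _ IH _ IH'|p0 q j {}v _ ij Hv].
- under eq_fun do rewrite mul0rz; exact: combo0.
- under eq_fun do rewrite mulrzDl; exact: comboD.
under eq_fun do rewrite -scaler_int scalerA mulrC -scalerA scaler_int -mulrzA.
by apply: (combo_gen _ _ ij Hv); exact: idP.
Qed.

(** A bracket of two terms of weight at least [i] has weight at least [i + i], which exceeds [i].
    This gain drives the inductions on the weight. *)
Lemma combo_ev (T : Type) (P : (T -> int) -> Prop) i U U' w : ideal P ->
  (0 < i)%N ->
  combo br A P i U -> combo br A P i U' ->
  combo br A P i (fun t => ev br w (U t) (U' t)) /\
  (isBr w -> combo br A P i.+1 (fun t => ev br w (U t) (U' t))).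
Proof.
move=> idP i0 HU HU'; elim: w => [||u [IHu _] v [IHv _]] //=.
have H : combo br A P (i + i) (fun t => br (ev br u (U t) (U' t)) (ev br v (U t) (U' t))).
  by apply: combo_brl => //; exact: combo_any IHv.
by split=> [|_]; apply: combo_weight H; lia.
Qed.

(** Writing $[u,v]-[u_1,v_1]$ as $[u-u_1,v]+[u_1,v-v_1]$ puts a difference of weight [i] next to a
    factor of weight at least 1. *)
Lemma combo_ev_congr (T : Type) (P : (T -> int) -> Prop) i U U1 W W1 w : ideal P ->
  (0 < i)%N ->
  combo br A (@anyp T) 1 U -> combo br A (@anyp T) 1 U1 ->
  combo br A (@anyp T) 1 W -> combo br A (@anyp T) 1 W1 ->
  combo br A P i (fun t => U t - U1 t) -> combo br A P i (fun t => W t - W1 t) ->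
  combo br A P i (fun t => ev br w (U t) (W t) - ev br w (U1 t) (W1 t)) /\
  (isBr w -> combo br A P i.+1
     (fun t => ev br w (U t) (W t) - ev br w (U1 t) (W1 t))).
Proof.
move=> idP i0 HU HU1 HW HW1 HUU HWW; elim: w => [||u [IHu _] v [IHv _]] //=.
have idA := @ideal_any T.
have Hv : combo br A (@anyp T) 1 (fun t => ev br v (U t) (W t)).
  by have [] := combo_ev v idA (leqnn 1) HU HW.
have Hu : combo br A (@anyp T) 1 (fun t => ev br u (U1 t) (W1 t)).
  by have [] := combo_ev u idA (leqnn 1) HU1 HW1.
suff H : combo br A P i.+1 (fun t => br (ev br u (U t) (W t)) (ev br v (U t) (W t)) -
   br (ev br u (U1 t) (W1 t)) (ev br v (U1 t) (W1 t))).
  by split=> // ; apply: combo_weight H.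
have -> : (fun t => br (ev br u (U t) (W t)) (ev br v (U t) (W t)) -
   br (ev br u (U1 t) (W1 t)) (ev br v (U1 t) (W1 t))) =
   (fun t => br (ev br u (U t) (W t) - ev br u (U1 t) (W1 t)) (ev br v (U t) (W t)) +
     br (ev br u (U1 t) (W1 t)) (ev br v (U t) (W t) - ev br v (U1 t) (W1 t))).
  by apply/funext => t; rewrite (brDl Hbr) (brDr Hbr) brNl brNr addrA subrK.
apply: comboD.
  by rewrite -addn1; exact: combo_brl.
by rewrite -add1n; exact: combo_brr.
Qed.

Lemma ev_line w x q q' : isBr w ->
  ev br w (ratr q *: x) (ratr q' *: x) = 0.
Proof.
suff [r [-> H]] : exists r, ev br w (ratr q *: x) (ratr q' *: x) = ratr r *: x /\
    (isBr w -> r = 0) by move=> /H ->; rewrite rmorph0 scale0r.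
elim: w => [||u [r [Hu _]] v [r' [Hv _]]] /=; [by exists q|by exists q'|].
exists 0; split=> //.
by rewrite Hu Hv (brZl Hbr) (brZr Hbr) (brxx Hbr) !scaler0 rmorph0 scale0r.
Qed.

End Combo.
End BracketTheory.

(** * Subgroups under a Baker-Campbell-Hausdorff law: clearing denominators weight by weight *)

Section BchTheory.
Variables (R : numFieldType) (V : lmodType R) (br : V -> V -> V) (c : nat).
Variables (op : V -> V -> V) (s : seq (rat * btree)).
Hypothesis Hop : bch_law br c op s.
Let Hbr := bch_br Hop.

(** All brackets vanish on a line, so [op] is addition there. Hence 0 is neutral, [- x] is the
    inverse of [x], and group powers are integer multiples. *)
Lemma op_line x q q' : op (ratr q *: x) (ratr q' *: x) = ratr (q + q') *: x.
Proof.
rewrite (bch_op Hop) /evs big1_seq ?addr0 ?rmorphD ?scalerDl// => p /andP[_ ps].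
by rewrite (ev_line Hbr) ?scaler0 //; exact: (allP (bch_isBr Hop)).
Qed.

Lemma opMz x m n : op (x *~ m) (x *~ n) = x *~ (m + n).
Proof. by have := op_line x m%:~R n%:~R; rewrite -rmorphD/= !ratr_int !scaler_int. Qed.

Lemma op0r x : op x 0 = x.
Proof. by have := opMz x 1 0; rewrite addr0 mulr0z mulr1z. Qed.

Lemma op0l x : op 0 x = x.
Proof. by have := opMz x 0 1; rewrite add0r mulr0z mulr1z. Qed.

Lemma opxN x : op x (- x) = 0.
Proof. by have := opMz x 1 (-1); rewrite mulrN1z mulr1z. Qed.

Lemma opNx x : op (- x) x = 0.
Proof. by have := opMz x (-1) 1; rewrite mulrN1z mulr1z. Qed.

Lemma op_NKr x y : op (op x (- y)) y = x.
Proof. by rewrite -(bch_opA Hop) opNx op0r. Qed.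

Lemma op_Kl x y : op (- x) (op x y) = y.
Proof. by rewrite (bch_opA Hop) opNx op0l. Qed.

Lemma op_NKl x y : op x (op (- x) y) = y.
Proof. by rewrite (bch_opA Hop) opxN op0l. Qed.

Section Op.
Variable A : set V.

Lemma combo_op (T : Type) (P : (T -> int) -> Prop) i U U' : ideal P -> (0 < i)%N ->
  combo br A P i U -> combo br A P i U' ->
  combo br A P i (fun t => op (U t) (U' t)) /\
  combo br A P i.+1 (fun t => op (U t) (U' t) - (U t + U' t)).
Proof.
move=> idP i0 HU HU'.
have H : combo br A P i.+1 (fun t => evs br s (U t) (U' t)).
  rewrite /evs; under eq_fun do rewrite big_seq.
  apply: combo_sum => p ps; apply: combo_scale.
  have [_] := combo_ev Hbr p.2 idP i0 HU HU'; apply.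
  exact: (allP (bch_isBr Hop)).
split; under eq_fun do rewrite (bch_op Hop).
  by apply: comboD; [exact: comboD|exact: combo_weight H].
by under eq_fun do rewrite addrAC subrr add0r.
Qed.

Lemma combo_op_congr (T : Type) (P : (T -> int) -> Prop) i U U1 W W1 : ideal P ->
  (0 < i)%N ->
  combo br A (@anyp T) 1 U -> combo br A (@anyp T) 1 U1 ->
  combo br A (@anyp T) 1 W -> combo br A (@anyp T) 1 W1 ->
  combo br A P i (fun t => U t - U1 t) -> combo br A P i (fun t => W t - W1 t) ->
  combo br A P i.+1 (fun t => op (U t) (W t) - op (U1 t) (W1 t) -
     ((U t - U1 t) + (W t - W1 t))).
Proof.
move=> idP i0 HU HU1 HW HW1 HUU HWW.
have -> : (fun t => op (U t) (W t) - op (U1 t) (W1 t) -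
     ((U t - U1 t) + (W t - W1 t))) =
   (fun t => \sum_(p <- s | p \in s)
     ratr p.1 *: (ev br p.2 (U t) (W t) - ev br p.2 (U1 t) (W1 t))).
  apply/funext => t; rewrite -big_seq !(bch_op Hop).
  under eq_bigr do rewrite scalerBr.
  rewrite sumrB -!/(evs _ _ _ _).
  set a := evs _ _ _ _; set b := evs _ _ _ _.
  rewrite (addrACA (U t)) -opprD.
  set p := U t + W t; set q := U1 t + W1 t.
  by rewrite (addrC p a) (addrC q b) [- (b + q)]opprD addrACA addrK.
apply: combo_sum => p ps; apply: combo_scale.
have [_] := combo_ev_congr Hbr p.2 idP i0 HU HU1 HW HW1 HUU HWW; apply.
exact: (allP (bch_isBr Hop)).
Qed.

End Op.

Section Subgroup.
Variable Gm : set V.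
Hypothesis Gm0 : Gm 0.
Hypothesis Gmop : forall x y, Gm x -> Gm y -> Gm (op x y).
Hypothesis GmN : forall x, Gm x -> Gm (- x).

Lemma Gm_Mz x n : Gm x -> Gm (x *~ n).
Proof.
move=> Hx; have Hn (k : nat) : Gm (x *~ k).
  elim: k => [|k IH]; first by rewrite mulr0z.
  by rewrite intS addrC -opMz mulr1z; exact: Gmop.
by case: n => k; rewrite ?NegzE ?mulrNz; [|apply: GmN].
Qed.

Lemma wspan_br i j v w : wspan br Gm i v -> wspan br Gm j w ->
  wspan br Gm (i + j) (br v w).
Proof. by move=> Hv Hw; apply: (combo_brl Hbr). Qed.

Lemma wspan_iter i j v w k : wspan br Gm i v -> wspan br Gm j w ->
  wspan br Gm (k * i + j) (iter k (br v) w).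
Proof.
move=> Hv Hw; elim: k => [//|k IH]; rewrite iterS mulSn -addnA.
exact: wspan_br.
Qed.

(* The group commutator of approximations of [x] and [y] approximates [br x y]. *)
Lemma bracket_approx j v : bracket_of br Gm j v ->
  exists2 g, Gm g & wspan br Gm j.+1 (g - v).
Proof.
have span_gen k w : bracket_of br Gm k w -> wspan br Gm k w.
  move=> Hw; rewrite /wspan.
  have := @combo_gen _ _ br Gm unit (@anyp unit) k (fun=> 1) 1 k w I (leqnn k) Hw.
  by under eq_fun do rewrite rmorph1 scale1r mulr1z.
elim=> {j v} [x Gx|i j x y Hx [g Gg Hg] Hy [h Gh Hh]].
  by exists x => //; rewrite subrr; exact: combo0.
have i0 := bracket_of_gt0 Hx; have j0 := bracket_of_gt0 Hy.
have Sg : wspan br Gm i g.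
  by rewrite -(subrK x g); apply: comboD; [exact: combo_weight Hg|exact: span_gen].
have Sh : wspan br Gm j h.
  by rewrite -(subrK y h); apply: comboD; [exact: combo_weight Hh|exact: span_gen].
pose y' := op (op g h) (- g).
exists (op y' (- h)).
  by apply: (Gmop (Gmop (Gmop _ _) (GmN _)) (GmN _)).
have S1 : wspan br Gm (i + j).+1 (y' - h - br g h).
  (* The terms of index 0 and 1 are [h] and [br g h]; the later ones have at least two letters [g],
     hence weight above [i + j]. *)
  rewrite /y' (bch_conj Hop) !big_ord_recl /= !fact0 invr1 rmorph1 !scale1r.
  rewrite [h + _]addrC addrK addrAC subrr add0r.
  apply: combo_sum => k _; apply: combo_scale.
  by apply: combo_weight (wspan_iter k.+2 Sg Sh); nia.
have S2 : wspan br Gm (i + j).+1 (br g h - br x y).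
  have -> : br g h - br x y = br (g - x) h + br x (h - y).
    by rewrite (brDl Hbr) (brDr Hbr) (brNl Hbr) (brNr Hbr) addrA subrK.
  apply: comboD; first by rewrite -addSn; exact: wspan_br.
  by rewrite -addnS; apply: wspan_br => //; exact: span_gen.
have S3 : wspan br Gm (i + j) (y' - h).
  rewrite -(subrK (br g h) (y' - h)).
  by apply: comboD; [exact: combo_weight S1|exact: wspan_br].
have Sh1 : wspan br Gm 1 h by exact: combo_weight Sh.
have Sy1 : wspan br Gm 1 y'.
  rewrite -(subrK h y'); apply: comboD => //.
  by apply: combo_weight S3; rewrite addn_gt0 i0.
have SN : wspan br Gm 1 (- h) by exact: comboN.
(* [op y' (- h)] is compared with [op h (- h)], which is 0; so it agrees with [y' - h] up to weight
   [(i + j).+1]. *)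
have := @combo_op_congr Gm unit (@anyp unit) (i + j)
  (fun=> y') (fun=> h) (fun=> - h) (fun=> - h) (@ideal_any _) _ Sy1 Sh1 SN SN S3.
rewrite addn_gt0 i0 /= opxN subr0 subrr addr0 => /(_ isT (combo0 _ _ _ _)) S4.
rewrite -(subrK (y' - h) (op _ _)) -addrA; apply: comboD => //.
by rewrite -(subrK (br g h) (y' - h)) -addrA; exact: comboD.
Qed.

(** The integer [k] is a large multiplier to be chosen later. Replacing it by a multiple clears
    denominators uniformly in [t]. *)
Definition divp (T : Type) (p : T * int -> int) : Prop :=
  forall t k, (k %| p (t, k))%Z.

Lemma ideal_div T : ideal (@divp T).
Proof. by move=> p p' Hp t k; rewrite dvdz_mull. Qed.

Lemma combo_rescale (T : Type) i (U : T * int -> V) K :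
  combo br Gm (@divp T) i U ->
  combo br Gm (@divp T) i (fun tk => U (tk.1, tk.2 * K)).
Proof.
move=> HU; apply: (combo_comp (f := fun tk => (tk.1, tk.2 * K)) _ HU).
by move=> p Hp t k /=; apply: dvdz_trans (Hp _ _); exact: dvdz_mulr.
Qed.

(** Once [K] has cleared the denominators, a term of weight exactly [i] is an integer multiple of a
    bracket word, which [bracket_approx] replaces by a group element. Terms of higher weight go into
    the error. *)
Lemma combo_approx (T : Type) i (U : T * int -> V) : (0 < i)%N ->
  combo br Gm (@divp T) i U ->
  exists K : int, exists g : T * int -> V, [/\ 0 < K,
    (forall tk, Gm (g tk)), combo br Gm (@divp T) i g &
    combo br Gm (@divp T) i.+1 (fun tk => U (tk.1, tk.2 * K) - g tk)].
Proof.
have idd := @ideal_div T.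
move=> i0; elim=> [|{}U U' HU [K [g [K0 Gg Sg Dg]]] HU' [K' [g' [K0' Gg' Sg' Dg']]]|p q j v Pp ij Hv].
- exists 1, (fun=> 0); split=> //; first exact: combo0.
  by under eq_fun do rewrite subr0; exact: combo0.
(* Each approximation is rescaled by the multiplier of the other one, so that both [U] and [U'] get
   evaluated at [tk.2 * (K * K')]. *)
- pose h tk := op (g (tk.1, tk.2 * K')) (g' (tk.1, tk.2 * K)).
  have H1 := combo_rescale K' Sg; have H2 := combo_rescale K Sg'.
  have [S1 S2] := combo_op idd i0 H1 H2.
  exists (K * K'), h; split; [exact: mulr_gt0|by move=> tk; exact: Gmop|exact: S1|].
  have := comboB (comboD (combo_rescale K' Dg) (combo_rescale K Dg')) S2.
  congr combo; apply/funext => -[t k] /=; rewrite /h /=.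
  rewrite -!mulrA (mulrC K' K) opprB addrA; congr (_ - _).
  by rewrite [X in X + _]addrACA -opprD subrK.
(* [p (t, k * b)] is divisible by [k * b]; dividing it by the denominator [b] of [q] leaves an
   integer that is still divisible by [k]. *)
pose b := denq q; pose a := numq q.
have b0 : b != 0 by exact: denq_neq0.
pose r (tk : T * int) : int := (p (tk.1, (tk.2 * b)%R) %/ b)%Z.
have rE t k : p (t, (k * b)%R) = r (t, k) * b.
  by rewrite /r divzK //= (dvdz_trans _ (Pp _ _)) // dvdz_mull.
have Pr : divp r.
  by move=> t k; rewrite -(dvdz_mul2r b0) -(rE t k).
have UE : (fun tk : T * int => ratr q *: (v *~ p (tk.1, (tk.2 * b)%R))) =
    (fun tk => v *~ (a * r tk)) :> (T * int -> V).
  apply/funext => -[t k] /=; rewrite rE -[in LHS](divq_num_den q) -/a -/b.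
  rewrite mulrzA -(scaler_int b) scalerA -(ratr_int R b) -rmorphM /= divfK ?intr_eq0 //.
  by rewrite ratr_int scaler_int -mulrzA [(a * _)%R]mulrC.
have Par : divp (fun tk => a * r tk) by exact: idd.
have [ij'|] := ltnP i j.
  exists b, (fun=> 0); split; [exact: denq_gt0|by []|exact: combo0|].
  under eq_fun do rewrite subr0.
  rewrite UE; have := @combo_gen _ _ br Gm _ (@divp T) i.+1 _ 1 j v Par ij' Hv.
  by under eq_fun do rewrite rmorph1 scale1r.
move=> ji; have {ij ji} ? : j = i by apply/eqP; rewrite eqn_leq ji.
subst j; have [g Gg Dg] := bracket_approx Hv.
have D' : combo br Gm (@divp T) i.+1 (fun tk => v *~ (a * r tk) - g *~ (a * r tk)).
  have := comboN (combo_const idd Par Dg).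
  by under eq_fun do rewrite mulrzBl opprB.
exists b, (fun tk => g *~ (a * r tk)); split.
- exact: denq_gt0.
- by move=> tk; exact: Gm_Mz.
- have := comboB (@combo_gen _ _ br Gm _ (@divp T) i _ 1 i v Par (leqnn i) Hv)
    (combo_weight (leqnSn i) D').
  by under eq_fun do rewrite rmorph1 scale1r opprB addrC subrK.
- move: D'; congr combo; apply/funext => tk; congr (_ - _).
  by rewrite -[LHS](congr1 (@^~ tk) UE).
Qed.

(* Induction on the weight: modulo higher weight, [U] is the logarithm of an
   element of the group, which can be divided out. *)
Lemma combo_in_group (T : Type) (U : T * int -> V) : combo br Gm (@divp T) 1 U ->
  exists2 K : int, 0 < K & forall t, Gm (U (t, K)).
Proof.
suff H m i U' : (2 ^ c < i + m)%N -> (0 < i)%N -> combo br Gm (@divp T) i U' ->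
    exists2 K : int, 0 < K & forall t, Gm (U' (t, K)).
  by move=> /(H (2 ^ c)%N 1%N); apply => //; lia.
elim: m i U' => [|m IH] i U' ci i0 HU.
  exists 1 => // t; rewrite (combo_large Hbr _ HU) //.
  by rewrite addn0 in ci.
have [K [g [K0 Gg Sg Dg]]] := combo_approx i0 HU.
have [_ S2] := combo_op (@ideal_div T) i0 (combo_rescale K HU) (comboN Sg).
have S3 := comboD S2 Dg.
have {}S3 : combo br Gm (@divp T) i.+1 (fun tk => op (U' (tk.1, tk.2 * K)) (- g tk)).
  by move: S3; congr combo; apply/funext => tk; rewrite subrK.
have [||K' K0' HK'] := IH _ _ _ _ S3; [lia|by []|].
exists (K' * K); first exact: mulr_gt0.
by move=> t; have := Gmop (HK' t) (Gg (t, K')); rewrite op_NKr.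
Qed.

End Subgroup.
End BchTheory.

Section RationalSpanTheory.
Variables (R : realType) (V : lmodType R).
Implicit Type A : set V.

Lemma Qspan_sub A v : A v -> Qspan A v.
Proof.
move=> Av; exists 1%N, (fun=> v), (fun=> 1); split=> //.
by rewrite big_ord1 rmorph1 scale1r.
Qed.

Lemma Qspan0 A : Qspan A 0.
Proof.
by exists 0%N, (fun=> 0), (fun=> 0); split=> [[]//|]; rewrite big_ord0.
Qed.

Lemma QspanZ A q v : Qspan A v -> Qspan A (ratr q *: v).
Proof.
move=> [d [a [c [Ha ->]]]]; exists d, a, (fun i => q * c i); split=> //.
by rewrite scaler_sumr; apply: eq_bigr => i _; rewrite scalerA rmorphM.
Qed.

Lemma QspanD A v w : Qspan A v -> Qspan A w -> Qspan A (v + w).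
Proof.
move=> [d [a [c [Ha ->]]]] [d' [a' [c' [Ha' ->]]]].
exists (d + d')%N, (fun i => match fintype.split i with inl j => a j | inr j => a' j end),
  (fun i => match fintype.split i with inl j => c j | inr j => c' j end); split.
  by move=> i; case: fintype.split.
rewrite big_split_ord /=; congr (_ + _); apply: eq_bigr => i _.
  by rewrite -[lshift _ _]/(unsplit (inl i)) unsplitK.
by rewrite -[rshift _ _]/(unsplit (inr i)) unsplitK.
Qed.

Lemma Qspan_sum A (I : Type) (r : seq I) (P : pred I) (F : I -> V) :
  (forall i, P i -> Qspan A (F i)) -> Qspan A (\sum_(i <- r | P i) F i).
Proof.
by move=> HF; elim/big_ind: _ => [|v w|i /HF//]; [exact: Qspan0|exact: QspanD].
Qed.

Lemma QspanN A v : Qspan A v -> Qspan A (- v).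
Proof. by move=> /(QspanZ (-1)); rewrite rmorphN1 scaleN1r. Qed.

Lemma QspanMz A v n : Qspan A v -> Qspan A (v *~ n).
Proof. by move=> /(QspanZ n%:~R); rewrite ratr_int scaler_int. Qed.

Lemma Qspan_ind A (P : set V) : P 0 -> (forall v w, P v -> P w -> P (v + w)) ->
  (forall q v, A v -> P (ratr q *: v)) -> Qspan A `<=` P.
Proof.
move=> P0 PD PZ _ [d [a [c [Ha ->]]]].
by elim/big_ind: _ => // i _; exact: PZ.
Qed.

Lemma Qspan_mono A B : A `<=` Qspan B -> Qspan A `<=` Qspan B.
Proof.
move=> AB; apply: Qspan_ind; [exact: Qspan0|by move=> *; exact: QspanD|].
by move=> q v /AB; exact: QspanZ.
Qed.

End RationalSpanTheory.

(** * The rational span of a subgroup and the lattices around the subgroup *)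

Section BchSpan.
Variables (R : realType) (V : lmodType R) (br : V -> V -> V) (c : nat).
Variables (op : V -> V -> V) (s : seq (rat * btree)).
Hypothesis Hop : bch_law br c op s.
Let Hbr := bch_br Hop.

Section Subgroup.
Variable Gm : set V.
Hypothesis Gm0 : Gm 0.
Hypothesis Gmop : forall x y, Gm x -> Gm y -> Gm (op x y).
Hypothesis GmN : forall x, Gm x -> Gm (- x).

Lemma wspan_multiple v : wspan br Gm 1 v -> exists2 K : int, 0 < K & Gm (v *~ K).
Proof.
move=> Hv; have P : divp (fun tk : unit * int => tk.2) by [].
have [K K0 HK] := combo_in_group Hop Gm0 Gmop GmN (combo_const (@ideal_div _) P Hv).
by exists K => //; exact: HK tt.
Qed.

(** Every rational combination of bracket words has a multiple in [Gm]. This is why the span of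
    $\log G$ is already closed under brackets. *)
Lemma Qspan_wspan : Qspan Gm = wspan br Gm 1.
Proof.
apply/seteqP; split=> v.
  apply: Qspan_ind; [exact: combo0|by move=> *; exact: comboD|].
  move=> q w Gw; have := @combo_gen _ _ br Gm unit (@anyp _) 1 (fun=> 1) q 1 w I
    (leqnn 1) (bracket_leaf _ Gw).
  by under eq_fun do rewrite mulr1z.
move=> /wspan_multiple[K K0 GK].
have -> : v = ratr (K%:~R^-1) *: (v *~ K).
  rewrite -(scaler_int K v) scalerA -(ratr_int R K) -rmorphM /= mulVf.
    by rewrite rmorph1 scale1r.
  by rewrite intr_eq0 gt_eqF.
by apply: QspanZ; exact: Qspan_sub.
Qed.

Lemma Qspan_multiple v : Qspan Gm v -> exists2 K : int, 0 < K & Gm (v *~ K).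
Proof. by rewrite Qspan_wspan; exact: wspan_multiple. Qed.

Lemma Qspan_br v w : Qspan Gm v -> Qspan Gm w -> Qspan Gm (br v w).
Proof.
rewrite Qspan_wspan => Hv Hw.
by apply: combo_weight (wspan_br Hop Hv Hw).
Qed.

Lemma Qspan_ev w x y : Qspan Gm x -> Qspan Gm y -> Qspan Gm (ev br w x y).
Proof. by move=> Hx Hy; elim: w => //= u Hu v Hv; exact: Qspan_br. Qed.

(* Modulo the functions divisible by [k], [op (- X) (X + k m)] is [op (- X) X = 0]. *)
Lemma lattice_coset d (b : 'I_d -> V) : (forall i, Qspan Gm (b i)) ->
  exists2 K : int, 0 < K & forall x m : 'I_d -> int,
    let X := \sum_i b i *~ x i in
    Gm (op (- X) (X + \sum_i b i *~ (m i * K))).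
Proof.
move=> Hb.
(* The coordinates [x] and [m] belong to the parameter, so the multiplier [K] found at the end does
   not depend on them. *)
pose X (t : ('I_d -> int) * ('I_d -> int) * int) := \sum_i b i *~ t.1.1 i.
pose Y (t : ('I_d -> int) * ('I_d -> int) * int) := \sum_i b i *~ (t.1.2 i * t.2).
have HX : combo br Gm (@anyp _) 1 X.
  apply: combo_sum => i _; apply: (combo_const (p := fun t => t.1.1 i)) => //.
  by rewrite -Qspan_wspan.
have HY : combo br Gm (@divp _) 1 Y.
  apply: combo_sum => i _; apply: (combo_const (p := fun t => t.1.2 i * t.2)).
  - exact: ideal_div.
  - by move=> t k; exact: dvdz_mull.
  - by rewrite -Qspan_wspan.
have HD : combo br Gm (@divp _) 1 (fun t => X t + Y t - X t).
  by under eq_fun do rewrite addrAC subrr add0r.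
have H0 : combo br Gm (@divp _) 1 (fun t => - X t - - X t).
  by under eq_fun do rewrite subrr; exact: combo0.
have H := combo_op_congr Hop (@ideal_div _) (leqnn 1) (comboN HX) (comboN HX)
  (comboD HX (combo_any HY)) HX H0 HD.
have {}H : combo br Gm (@divp _) 1 (fun t => op (- X t) (X t + Y t)).
  have := comboD (combo_weight (leqnSn 1) H) HY.
  congr combo; apply/funext => t.
  by rewrite (opNx Hop) subr0 subrr add0r [X t + _ - _]addrAC subrr add0r subrK.
have [K K0 HK] := combo_in_group Hop Gm0 Gmop GmN H.
by exists K => // x m; exact: (HK (x, m)).
Qed.

End Subgroup.

(** Brackets add the indices [e], and division by [D] lowers the index by one. So a proper bracket
    of elements of index 1, having index 2, may be divided by [D] without leaving index 1. *)
Inductive zcombo (D : nat) (A : set V) (e : nat) : V -> Prop :=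
| zcombo0 : zcombo D A e 0
| zcomboD x y : zcombo D A e x -> zcombo D A e y -> zcombo D A e (x + y)
| zcombo_gen j v n : (e <= j)%N -> bracket_of br A j v ->
    zcombo D A e (ratr (D%:R ^- (j - e)) *: (v *~ n)).

Section Lattice.
Variables (D : nat) (A : set V).
Hypothesis D0 : (0 < D)%N.

Lemma zcomboMz e x n : zcombo D A e x -> zcombo D A e (x *~ n).
Proof.
elim=> [|y z _ IHy _ IHz|j v m ej Hv]; first by rewrite mul0rz; exact: zcombo0.
  by rewrite mulrzDl; exact: zcomboD.
rewrite -scaler_int scalerA mulrC -scalerA scaler_int -mulrzA.
exact: zcombo_gen.
Qed.

Lemma zcombo_sum e (I : Type) (r : seq I) (P : pred I) (F : I -> V) :
  (forall i, P i -> zcombo D A e (F i)) -> zcombo D A e (\sum_(i <- r | P i) F i).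
Proof.
move=> HF; elim/big_ind: _ => [|v w|i /HF//]; [exact: zcombo0|exact: zcomboD].
Qed.

Lemma zcombo_br e f x y : zcombo D A e x -> zcombo D A f y ->
  zcombo D A (e + f) (br x y).
Proof.
move=> Hx Hy; elim: Hx => [|x1 x2 _ IH1 _ IH2|j v n ej Hv].
- by rewrite (br0l Hbr); exact: zcombo0.
- by rewrite (brDl Hbr); exact: zcomboD.
elim: Hy => [|y1 y2 _ IH1 _ IH2|k w m fk Hw].
- by rewrite (br0r Hbr); exact: zcombo0.
- by rewrite (brDr Hbr); exact: zcomboD.
rewrite (brZl Hbr) (brZr Hbr) scalerA -rmorphM /= (brMzl Hbr) (brMzr Hbr) -mulrzA.
rewrite -invfM -exprD.
have -> : (j - e + (k - f) = j + k - (e + f))%N by lia.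
by apply: zcombo_gen; [exact: leq_add|exact: bracket_br].
Qed.

Lemma zcombo_div e x : zcombo D A e.+1 x -> zcombo D A e (ratr (D%:R^-1) *: x).
Proof.
elim=> [|y z _ IHy _ IHz|j v m ej Hv]; first by rewrite scaler0; exact: zcombo0.
  by rewrite scalerDr; exact: zcomboD.
rewrite scalerA -rmorphM /= -invfM -exprS.
have -> : (j - e.+1).+1 = (j - e)%N by lia.
by apply: zcombo_gen => //; exact: ltnW.
Qed.

Lemma zcombo_weak e f x : (e <= f)%N -> zcombo D A f x -> zcombo D A e x.
Proof.
move=> /subnKC <-; elim: (f - e)%N x => {f} [|k IH] x; first by rewrite addn0.
rewrite addnS => /zcombo_div /(zcomboMz D); rewrite -scaler_int scalerA.
rewrite -(ratr_int R D) -rmorphM /= divff ?pnatr_eq0 -?lt0n// rmorph1 scale1r.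
exact: IH.
Qed.

Lemma zcombo_ev w x y : zcombo D A 1 x -> zcombo D A 1 y ->
  zcombo D A 1 (ev br w x y) /\ (isBr w -> zcombo D A 2 (ev br w x y)).
Proof.
move=> Hx Hy; elim: w => [||u [Hu _] v [Hv _]] //=.
have H := zcombo_br Hu Hv.
by split=> // ; exact: zcombo_weak H.
Qed.

Lemma zcombo_op x y :
  (forall p, p \in s -> exists m : int, p.1 = m%:~R / D%:R) ->
  zcombo D A 1 x -> zcombo D A 1 y -> zcombo D A 1 (op x y).
Proof.
move=> sD Hx Hy; rewrite (bch_op Hop); apply: zcomboD; first exact: zcomboD.
rewrite /evs big_seq; apply: zcombo_sum => p ps.
have [m ->] := sD p ps.
rewrite rmorphM /= ratr_int -scalerA scaler_int; apply: zcomboMz.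
apply: zcombo_div; have [_] := zcombo_ev p.2 Hx Hy; apply.
exact: (allP (bch_isBr Hop)).
Qed.

End Lattice.

(** The weight is recorded because the scaling in [zcombo] depends on it. Words nested too deeply to
    be listed for [k = c] vanish, so this finite list yields generators of the lattice. *)
Fixpoint brackets (gens : seq V) (k : nat) : seq (nat * V) :=
  let l := [seq (1%N, x) | x <- gens] in
  if k is k'.+1 then
    l ++ [seq ((p.1 + q.1)%N, br p.2 q.2) |
           p <- brackets gens k', q <- brackets gens k']
  else l.

Lemma mem_brackets gens k p : p \in brackets gens k ->
  bracket_of br [set` gens] p.1 p.2.
Proof.
have H q : q \in [seq (1%N, x) | x <- gens] -> bracket_of br [set` gens] q.1 q.2.
  by move=> /mapP[x xg ->]; exact: bracket_leaf.
elim: k p => [|k IH] p /=; first exact: H.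
rewrite mem_cat => /orP[/H//|/allpairsP[[q r] [/= /IH Hq /IH Hr ->]]].
exact: bracket_br.
Qed.

Lemma bracket_brackets gens j v k : bracket_of br [set` gens] j v ->
  (j, v) \in brackets gens k \/
  exists xs y, size xs = k.+1 /\ v = foldr br y xs.
Proof.
move=> H; elim: H k => {j v} [x xg|i j x y _ IHx _ IHy] k.
  left; have H : (1%N, x) \in [seq (1%N, x) | x <- gens] by exact: map_f.
  by case: k => [//|k]; rewrite /= mem_cat H.
case: k => [|k]; first by right; exists [:: x], y.
have [Hx|[xs [y' [sxs ->]]]] := IHx k; last first.
  right; exists (- y :: xs), y'.
  by rewrite /= sxs (brNl Hbr) -(br_anti Hbr).
have [Hy|[xs [y' [sxs ->]]]] := IHy k; last first.
  by right; exists (x :: xs), y'; rewrite /= sxs.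
left; rewrite /= mem_cat; apply/orP; right.
by apply/allpairsP; exists ((i, x), (j, y)).
Qed.

(* Scaling weight [j] by [D^(1-j)] absorbs the denominators of the
   Baker-Campbell-Hausdorff coefficients. *)
Lemma group_lattice (gens : seq V) : exists d (b : 'I_d -> V),
  (forall i, exists q j v, b i = ratr q *: v /\ bracket_of br [set` gens] j v) /\
  exists M : set V, [/\ M 0, forall x, M x -> M (- x),
    forall x y, M x -> M y -> M (op x y), [set` gens] `<=` M &
    forall x, M x -> exists n : 'I_d -> int, x = \sum_i b i *~ n i].
Proof.
pose D := (\prod_(p <- s) `|denq p.1|)%N.
have D0 : (0 < D)%N.
  by apply: prodn_gt0 => p; rewrite absz_gt0 denq_neq0.
have sD p : p \in s -> exists m : int, p.1 = m%:~R / D%:R.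
  move=> ps; exists (numq p.1 * (D %/ `|denq p.1|)%N).
  have dD : (`|denq p.1| %| D)%N by rewrite /D (big_rem p ps) /= dvdn_mulr.
  rewrite -[in LHS](divq_num_den p.1) intrM -mulrA; congr (_ * _).
  rewrite -[in D%:R](divnK dD) natrM invfM mulrA pmulrn divff ?mul1r.
    by rewrite pmulrn abszE gtr0_norm // denq_gt0.
  by rewrite intr_eq0 -lt0n divn_gt0 ?absz_gt0 ?denq_neq0 // dvdn_leq.
pose l := brackets gens c; pose d := size l.
pose f (p : nat * V) := ratr (D%:R ^- (p.1 - 1)) *: p.2.
pose b (i : 'I_d) := f (nth (0%N, 0) l i).
exists d, b; split.
  move=> i; exists (D%:R ^- ((nth (0%N, 0) l i).1 - 1)), (nth (0%N, 0) l i).1,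
    (nth (0%N, 0) l i).2; split => //.
  by apply: (@mem_brackets _ c); exact: mem_nth.
exists (zcombo D [set` gens] 1); split.
- exact: zcombo0.
- by move=> x /(zcomboMz (-1)); rewrite mulrN1z.
- by move=> x y; exact: zcombo_op.
- move=> x xg; have := @zcombo_gen D [set` gens] 1 1 x 1 (leqnn 1) (bracket_leaf _ xg).
  by rewrite subnn expr0 invr1 rmorph1 scale1r mulr1z.
move=> x; elim=> [|y z _ [ny ->] _ [nz ->]|j v n j0 Hv].
- by exists (fun=> 0); rewrite big1 // => i _; rewrite mulr0z.
- exists (fun i => ny i + nz i); rewrite -big_split /=.
  by apply: eq_bigr => i _; rewrite mulrzDr.
have [jv|[xs [y [sxs ->]]]] := bracket_brackets c Hv; last first.
  exists (fun=> 0); rewrite big1; last by move=> i _; rewrite mulr0z.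
  case: xs sxs => //= z xs [sxs].
  by rewrite (br_nil Hbr y sxs) (br0r Hbr) mul0rz scaler0.
have il : (index (j, v) l < d)%N by rewrite index_mem.
exists (fun i => if i == Ordinal il then n else 0).
rewrite (bigD1 (Ordinal il)) //= eqxx big1 ?addr0.
  by rewrite /b /f nth_index //= scalerMzr.
by move=> i /negPf ->; rewrite mulr0z.
Qed.

End BchSpan.

(** * The formal Baker-Campbell-Hausdorff series *)

(* Formal rational combinations of bracket words in a constant [LX] and a curve
   [LY] whose velocity is the combination [P]. *)
Section FormalDerivation.
Implicit Types (f : seq (rat * btree)) (w : btree).

Definition fscale (q : rat) f := [seq (q * p.1, p.2) | p <- f].

Definition fmap (F : btree -> btree) f := [seq (p.1, F p.2) | p <- f].

Fixpoint wderiv (P : seq (rat * btree)) w : seq (rat * btree) :=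
  match w with
  | LX => [::]
  | LY => P
  | Br u v => fmap (Br^~ v) (wderiv P u) ++ fmap (Br u) (wderiv P v)
  end.

Definition fderiv P f := flatten [seq fscale p.1 (wderiv P p.2) | p <- f].

Fixpoint countX w : nat :=
  match w with LX => 1 | LY => 0 | Br u v => countX u + countX v end%N.

Fixpoint leaves w : nat :=
  if w is Br u v then (leaves u + leaves v)%N else 1%N.

Definition allX k f := all (fun p => k <= countX p.2)%N f.
Definition allBr f := all (fun p => isBr p.2) f.

Lemma all_flatten_map (I T : Type) (a : pred T) (F : I -> seq T) r :
  all a (flatten [seq F i | i <- r]) = all (fun i => all a (F i)) r.
Proof. by elim: r => //= i r IH; rewrite all_cat IH. Qed.

Lemma countX_leaves w : (countX w <= leaves w)%N.
Proof. by elim: w => //= u Hu v Hv; exact: leq_add. Qed.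

Lemma allBr_scale q f : allBr (fscale q f) = allBr f.
Proof. by rewrite /allBr all_map. Qed.

(** A derivation substitutes for one letter [LY] words that each contain an [LX], and keeps the
    other letters. *)
Lemma allX_wderiv P w : allX 1 P -> allX (countX w).+1 (wderiv P w).
Proof.
move=> HP; elim: w => [//|//|u Hu v Hv] /=.
rewrite /allX all_cat !all_map; apply/andP; split.
  by apply/allP => p /(allP Hu) /=; lia.
by apply/allP => p /(allP Hv) /=; lia.
Qed.

Lemma allX_fderiv P k f : allX 1 P -> allX k f -> allX k.+1 (fderiv P f).
Proof.
move=> HP Hf; rewrite /fderiv /allX all_flatten_map; apply/allP => p pf /=.
rewrite all_map; apply/allP => q /(allP (allX_wderiv p.2 HP)) /=.
exact: leq_ltn_trans (allP Hf _ pf).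
Qed.

Lemma allBr_wderiv P w : isBr w -> allBr (wderiv P w).
Proof.
case: w => //= u v _; rewrite /allBr all_cat !all_map.
by apply/andP; split; apply/allP.
Qed.

Lemma allBr_fderiv P f : allBr f -> allBr (fderiv P f).
Proof.
move=> Hf; rewrite /fderiv /allBr all_flatten_map; apply/allP => p pf /=.
by rewrite -/(allBr _) allBr_scale; apply: allBr_wderiv; exact: (allP Hf).
Qed.

End FormalDerivation.

Section FormalEval.
Variables (R : numFieldType) (V : lmodType R) (br : V -> V -> V) (c : nat).
Hypothesis Hbr : nil_bracket br c.

Lemma evs_cat f g x y : evs br (f ++ g) x y = evs br f x y + evs br g x y.
Proof. by rewrite /evs big_cat. Qed.

Lemma evs_nil x y : evs br [::] x y = 0.
Proof. by rewrite /evs big_nil. Qed.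

Lemma evs_cons p f x y : evs br (p :: f) x y = ratr p.1 *: ev br p.2 x y + evs br f x y.
Proof. by rewrite /evs big_cons. Qed.

Lemma evs_scale q f x y : evs br (fscale q f) x y = ratr q *: evs br f x y.
Proof.
rewrite /evs big_map scaler_sumr; apply: eq_bigr => p _ /=.
by rewrite rmorphM scalerA.
Qed.

Lemma evs_flatten (I : Type) (r : seq I) (F : I -> seq (rat * btree)) x y :
  evs br (flatten [seq F i | i <- r]) x y = \sum_(i <- r) evs br (F i) x y.
Proof.
elim: r => [|i r IH]; first by rewrite big_nil evs_nil.
by rewrite big_cons /= evs_cat IH.
Qed.

Lemma evs_fmap_brr w f x y :
  evs br (fmap (Br w) f) x y = br (ev br w x y) (evs br f x y).
Proof.
elim: f => [|p f IH]; first by rewrite !evs_nil (br0r Hbr).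
by rewrite /= !evs_cons IH /= (brDr Hbr) (brZr Hbr).
Qed.

Lemma evs_fmap_brl w f x y :
  evs br (fmap (Br^~ w) f) x y = br (evs br f x y) (ev br w x y).
Proof.
elim: f => [|p f IH]; first by rewrite !evs_nil (br0l Hbr).
by rewrite /= !evs_cons IH /= (brDl Hbr) (brZl Hbr).
Qed.

Lemma evs_allX f x y k : (2 ^ c < k)%N -> allX k f -> evs br f x y = 0.
Proof.
move=> ck Hf; rewrite /evs big1_seq // => p /andP[_ /(allP Hf) /= pk].
have H w : bracket_of br [set x; y] (leaves w) (ev br w x y).
  elim: w => [||u Hu v Hv] /=; [by apply: bracket_leaf; left|
    by apply: bracket_leaf; right|exact: bracket_br].
rewrite (bracket_nil Hbr (H _)) ?scaler0 //.
exact: leq_trans ck (leq_trans pk (countX_leaves _)).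
Qed.

End FormalEval.

(* With [a] the nilpotent operator [br y], the series [sum_(j < c) a^j / (j+1)!]
   is inverted by the geometric series of [1] minus it. *)
Definition fstep (c : nat) (f : seq (rat * btree)) : seq (rat * btree) :=
  flatten [seq fscale (- (j.+2`!%:R^-1)) (fmap (iter j.+1 (Br LY)) f) | j <- iota 0 c].

(** The geometric series without its term of order zero, the letter [LX]; what remains consists of
    proper brackets. *)
Definition velocity_tail (c : nat) : seq (rat * btree) :=
  flatten [seq iter k.+1 (fstep c) [:: (1, LX)] | k <- iota 0 c].

Definition velocity (c : nat) := (1, LX) :: velocity_tail c.

Lemma allBr_velocity_tail c : allBr (velocity_tail c).
Proof.
rewrite /allBr all_flatten_map; apply/allP => k _ /=.
rewrite all_flatten_map; apply/allP => j _ /=.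
by rewrite !all_map; apply/allP.
Qed.

Lemma allX_velocity c : allX 1 (velocity c).
Proof.
have H k f : allX 1 f -> allX 1 (iter k (fstep c) f).
  move=> Hf; elim: k => //= k IH.
  rewrite /fstep /allX all_flatten_map; apply/allP => j _ /=.
  rewrite !all_map; apply/allP => p /(allP IH) /= Hp.
  by elim: j => //= j; rewrite add0n.
rewrite /velocity /allX /= all_flatten_map; apply/allP => k _ /=.
exact: (H k.+1).
Qed.

Section Velocity.
Variables (R : numFieldType) (V : lmodType R) (br : V -> V -> V) (c : nat).
Hypothesis Hbr : nil_bracket br c.

Lemma iter_br_nil y w k : (c <= k)%N -> iter k (br y) w = 0.
Proof.
move=> /subnK <-; rewrite iterD.
have -> : iter c (br y) w = 0.
  have <- : foldr br w (nseq c y) = 0 by apply: (br_nil Hbr); rewrite size_nseq.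
  by elim: c => //= k' ->.
by elim: (k - c)%N => //= k' ->; rewrite (br0r Hbr).
Qed.

Lemma evs_fmap_iter k f x y :
  evs br (fmap (iter k (Br LY)) f) x y = iter k (br y) (evs br f x y).
Proof.
elim: k => [|k IH] /=.
  by congr evs; rewrite /fmap -[RHS]map_id; apply: eq_map => -[].
rewrite -IH -(evs_fmap_brr Hbr LY); congr evs.
by rewrite /fmap -map_comp.
Qed.

Definition nstep y w := - \sum_(j < c) ratr (j.+2`!%:R^-1) *: iter j.+1 (br y) w.

Lemma evs_fstep f x y : evs br (fstep c f) x y = nstep y (evs br f x y).
Proof.
rewrite evs_flatten /nstep -sumrN -[in RHS](big_mkord xpredT
  (fun j => - (ratr (j.+2`!%:R^-1) *: iter j.+1 (br y) (evs br f x y)))).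
rewrite /index_iota subn0; apply: eq_bigr => j _.
by rewrite evs_scale evs_fmap_iter rmorphN scaleNr.
Qed.

Lemma iter_brD y k w w' : iter k (br y) (w + w') = iter k (br y) w + iter k (br y) w'.
Proof. by elim: k => //= k ->; rewrite (brDr Hbr). Qed.

Lemma iter_brN y k w : iter k (br y) (- w) = - iter k (br y) w.
Proof. by elim: k => //= k ->; rewrite (brNr Hbr). Qed.

Lemma iter_brZ y k q w : iter k (br y) (ratr q *: w) = ratr q *: iter k (br y) w.
Proof. by elim: k => //= k ->; rewrite (brZr Hbr). Qed.

Lemma iter_br_sum y k d (F : 'I_d -> V) :
  iter k (br y) (\sum_i F i) = \sum_i iter k (br y) (F i).
Proof.
have H0 : iter k (br y) 0 = 0 by elim: k => //= k ->; rewrite (br0r Hbr).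
exact: (big_morph _ (iter_brD y k) H0).
Qed.

Lemma nstepD y w w' : nstep y (w + w') = nstep y w + nstep y w'.
Proof.
rewrite /nstep -opprD -big_split; congr (- _); apply: eq_bigr => j _ /=.
by rewrite -!iterS iter_brD scalerDr.
Qed.

(** [nstep y] is a polynomial in [br y] without constant term, so after [k] steps only [c - k]
    further brackets with [y] are needed to reach 0. *)
Lemma nstep_nil y w : iter c (nstep y) w = 0.
Proof.
suff H k : (k <= c)%N -> iter (c - k) (br y) (iter k (nstep y) w) = 0.
  by have := H c (leqnn c); rewrite subnn.
elim: k => [_|k IH kc]; first by rewrite subn0 iter_br_nil.
rewrite iterS {1}/nstep iter_brN iter_br_sum big1 ?oppr0 // => j _.
rewrite iter_brZ -iterD.
have -> : (c - k.+1 + j.+1 = j + (c - k))%N by lia.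
rewrite iterD (IH (ltnW kc)).
have -> : iter j (br y) 0 = 0 by elim: (nat_of_ord j) => //= j' ->; rewrite (br0r Hbr).
by rewrite scaler0.
Qed.

(** The hypothesis reads [w = x + nstep y w]. Iterating it [c.+1] times gives the geometric series
    in [nstep y] and a remainder that nilpotency kills. *)
Lemma evs_velocity x y w :
  x = \sum_(j < c.+1) ratr (j.+1`!%:R^-1) *: iter j (br y) w ->
  w = evs br (velocity c) x y.
Proof.
rewrite big_ord_recl (_ : 1`! = 1%N) //= invr1 rmorph1 scale1r => Hx.
have E : w = x + nstep y w by rewrite Hx /nstep addrK.
have D k a b : iter k (nstep y) (a + b) = iter k (nstep y) a + iter k (nstep y) b.
  by elim: k => //= k ->; rewrite nstepD.
have H k : w = \sum_(i < k) iter i (nstep y) x + iter k (nstep y) w.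
  elim: k => [|k IH]; first by rewrite big_ord0 add0r.
  rewrite {1}IH big_ord_recr /= -addrA; congr (_ + _).
  by rewrite -iterS iterSr -D -E.
have {}H := H c.+1.
rewrite iterS nstep_nil in H.
have n0 : nstep y 0 = 0.
  by have := nstepD y 0 0; rewrite addr0 => /eqP; rewrite -subr_eq0 opprD addNKr oppr_eq0 => /eqP.
rewrite {1}H n0 addr0 big_ord_recl /= evs_cons rmorph1 scale1r; congr (_ + _).
rewrite /velocity_tail evs_flatten.
rewrite -(big_mkord xpredT (fun i => nstep y (iter i (nstep y) x))).
rewrite /index_iota subn0; apply: eq_bigr => k _.
rewrite -iterS; elim: k.+1 => [|k' IH] /=; last by rewrite evs_fstep IH.
by rewrite evs_cons evs_nil addr0 rmorph1 scale1r.
Qed.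

End Velocity.

(** * Groups with analytic exponential coordinates *)

Section Curves.
Variable R : realType.
Implicit Types U V W : normedModType R.

Lemma is_derive_line V (v : V) (t : R) : is_derive t 1 (fun s : R => s *: v) v.
Proof.
have df : is_diff t (fun s : R => s *: v) (fun s : R => s *: v).
  exact: (is_diff_scalel t v).
apply: DeriveDef; first by apply: diff_derivable; exact: ex_diff.
by rewrite deriveE ?diff_val ?scale1r //; exact: ex_diff.
Qed.

Lemma is_derive_uniq V (g : R -> V) (t : R) dg dg' :
  is_derive t 1 g dg -> is_derive t 1 g dg' -> dg = dg'.
Proof. by move=> [_ <-] [_ <-]. Qed.

Lemma is_derive_comp U V (f : U -> V) (g : R -> U) (t : R) dg :
  differentiable f (g t) -> is_derive t 1 g dg ->
  is_derive t 1 (fun s => f (g s)) ('d f (g t) dg).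
Proof.
move=> df [/derivable1_diffP dg' <-].
have dfg : differentiable (f \o g) t by exact: differentiable_comp.
apply: DeriveDef; first exact: diff_derivable.
by rewrite (deriveE _ dfg) diff_comp //= (deriveE _ dg').
Qed.

Lemma is_derive_pair U V (f : R -> U) (g : R -> V) (t : R) df dg :
  is_derive t 1 f df -> is_derive t 1 g dg ->
  is_derive t 1 (fun s => (f s, g s)) (df, dg).
Proof.
move=> [/derivable1_diffP df' <-] [/derivable1_diffP dg' <-].
have dfg : differentiable (fun s => (f s, g s)) t by exact: differentiable_pair.
apply: DeriveDef; first exact: diff_derivable.
by rewrite deriveE // diff_pair //= !deriveE.
Qed.

Lemma is_derive_coord n (g : R -> 'rV[R]_n) (t : R) dg i : is_derive t 1 g dg ->
  is_derive t 1 (fun s => g s 0 i) (dg 0 i).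
Proof.
move=> [dx vx]; apply: DeriveDef; first exact: (derivable_mxP _ _ _).1.
by have := derive_mx dx; rewrite vx => /(congr1 (fun M : 'rV_n => M 0 i)); rewrite !mxE.
Qed.

Lemma is_derive_0_cst n (g : R -> 'rV[R]_n) :
  (forall t : R, is_derive t 1 g 0) -> forall s t, g s = g t.
Proof.
move=> dg s t; apply/rowP => i.
apply: (@is_derive_0_is_cst R (fun x => g x 0 i)) => x.
by have := is_derive_coord i (dg x); rewrite mxE.
Qed.

Lemma is_derive_scalev V (k : R -> R) (v : V) (t dk : R) :
  is_derive t 1 k dk -> is_derive t 1 (fun s => k s *: v) (dk *: v).
Proof.
move=> [/derivable1_diffP dk' <-].
have dkv := differentiableZl v dk'.
apply: DeriveDef; first exact: diff_derivable.
by rewrite deriveE // diffZl //= deriveE.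
Qed.

Lemma is_derive_bigsum V d (h : 'I_d -> R -> V) (t : R) (dh : 'I_d -> V) :
  (forall i, is_derive t 1 (h i) (dh i)) ->
  is_derive t 1 (fun s => \sum_(i < d) h i s) (\sum_(i < d) dh i).
Proof. by move=> /is_derive_sum; rewrite fct_sumE. Qed.

Lemma is_derive_pow_fact (j : nat) (t : R) :
  is_derive t 1 (fun s : R => s ^+ j.+1 / j.+1`!%:R) (t ^+ j / j`!%:R).
Proof.
have H := is_derive_poly ((j.+1`!%:R)^-1 *: 'X^(j.+1)) t.
have -> : (fun s : R => s ^+ j.+1 / j.+1`!%:R) =
    horner ((j.+1`!%:R)^-1 *: 'X^(j.+1)).
  by apply/funext => s; rewrite hornerZ hornerXn mulrC.
apply: (is_derive_eq H); rewrite derivZ derivXn hornerZ hornerMn hornerXn /=.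
rewrite factS natrM invfM -(mulr_natl (t ^+ j)) mulrACA mulVf ?mul1r 1?mulrC //.
Qed.

(** By induction the derivative [g 1] is a polynomial; subtracting its termwise primitive from [g 0]
    leaves a curve with zero derivative. *)
Lemma taylor_curve n (g : nat -> R -> 'rV[R]_n) K :
  (forall j (t : R), is_derive t 1 (g j) (g j.+1 t)) -> (forall t, g K t = 0) ->
  forall t, g 0%N t = \sum_(j < K) (t ^+ j / j`!%:R) *: g j 0.
Proof.
elim: K g => [|K IH] g dg gK t; first by rewrite big_ord0.
have {}IH := IH (fun j => g j.+1) (fun j => dg j.+1) gK.
pose h (s : R) := g 0%N s - \sum_(j < K) (s ^+ j.+1 / j.+1`!%:R) *: g j.+1 0.
have /(_ t 0) : forall s s', h s = h s'.
  apply: is_derive_0_cst => s.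
  have dsum : is_derive s 1 (fun s => \sum_(j < K) (s ^+ j.+1 / j.+1`!%:R) *: g j.+1 0)
      (\sum_(j < K) (s ^+ j / j`!%:R) *: g j.+1 0).
    apply: is_derive_bigsum => j; apply: is_derive_scalev.
    exact: is_derive_pow_fact.
  by apply: (is_derive_eq (is_deriveB (dg 0%N s) dsum)); rewrite IH subrr.
rewrite /h big_ord_recl expr0 fact0 divr1 scale1r => /(canRL (subrK _)) ->.
rewrite [X in _ - X]big1 ?subr0 // => i _.
by rewrite exprS !mul0r scale0r.
Qed.

End Curves.

(** * Conjugation, bracket and product in exponential coordinates *)

Section AnalyticGroup.
Variables (R : realType) (n : nat).
Local Notation V := 'rV[R]_n.
Variable op : V -> V -> V.
Hypothesis opA : associative op.
Hypothesis op_homog : forall (s t : R) x, op (s *: x) (t *: x) = (s + t) *: x.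
Hypothesis op_diff : forall p, differentiable (fun q : V * V => op q.1 q.2) p.

Lemma op_0x x : op 0 x = x.
Proof. by have := op_homog 0 1 x; rewrite scale0r add0r scale1r. Qed.

Lemma op_x0 x : op x 0 = x.
Proof. by have := op_homog 1 0 x; rewrite scale0r addr0 scale1r. Qed.

Lemma op_xN x : op x (- x) = 0.
Proof. by have := op_homog 1 (-1) x; rewrite scale1r scaleN1r subrr scale0r. Qed.

Lemma op_Nx x : op (- x) x = 0.
Proof. by have := op_homog (-1) 1 x; rewrite scale1r scaleN1r addNr scale0r. Qed.

Lemma op_NK x y : op (op x (- y)) y = x.
Proof. by rewrite -opA op_Nx op_x0. Qed.

Lemma op_KN x y : op (op x y) (- y) = x.
Proof. by rewrite -opA op_xN op_x0. Qed.

Lemma is_derive_op (g h : R -> V) (t : R) dg dh :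
  is_derive t 1 g dg -> is_derive t 1 h dh ->
  is_derive t 1 (fun s => op (g s) (h s))
    ('d (fun q : V * V => op q.1 q.2) (g t, h t) (dg, dh)).
Proof.
move=> Hg Hh.
exact: (is_derive_comp (op_diff (g t, h t)) (is_derive_pair Hg Hh)).
Qed.

Lemma diff_op0 (a b : V) : 'd (fun q : V * V => op q.1 q.2) (0, 0) (a, b) = a + b.
Proof.
have d1 : 'd (fun q : V * V => op q.1 q.2) (0, 0) (a, 0) = a.
  have := is_derive_op (is_derive_line a 0) (is_derive_cst 0 (0 : R) 1).
  rewrite scale0r => /is_derive_uniq; apply.
  under eq_fun do rewrite op_x0.
  exact: is_derive_line.
have d2 : 'd (fun q : V * V => op q.1 q.2) (0, 0) (0, b) = b.
  have := is_derive_op (is_derive_cst 0 (0 : R) 1) (is_derive_line b 0).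
  rewrite scale0r => /is_derive_uniq; apply.
  under eq_fun do rewrite op_0x.
  exact: is_derive_line.
have -> : (a, b) = (a, 0) + (0, b) :> V * V.
  by rewrite [RHS]surjective_pairing /= addr0 add0r.
by rewrite linearD /= d1 d2.
Qed.

Lemma is_derive_op0 (g h : R -> V) (t : R) dg dh : g t = 0 -> h t = 0 ->
  is_derive t 1 g dg -> is_derive t 1 h dh ->
  is_derive t 1 (fun s => op (g s) (h s)) (dg + dh).
Proof.
by move=> g0 h0 Hg Hh; have := is_derive_op Hg Hh; rewrite g0 h0 diff_op0.
Qed.

(* [z t] is [k *: z (t / k)] for every [k], which tends to [t *: dz]. *)
Lemma one_parameter (z : R -> V) dz : (forall s t, z (s + t) = op (z s) (z t)) ->
  is_derive (0 : R) 1 z dz -> forall t, z t = t *: dz.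
Proof.
move=> zD [Dz Dzv] t.
have zM (k : nat) s : z (k.+1%:R * s) = k.+1%:R *: z s.
  elim: k => [|k IH]; first by rewrite mul1r scale1r.
  by rewrite -natr1 mulrDl mul1r zD IH -{2}[z s]scale1r op_homog.
have z0 : z 0 = 0.
  have := zM 1%N 0; rewrite mulr0 -[LHS]scale1r => /eqP.
  rewrite eq_sym -subr_eq0 -scalerBl -natr1 addrK scaler_eq0 oner_eq0 /=.
  by move/eqP.
have [->|t0] := eqVneq t 0; first by rewrite scale0r.
suff : t^-1 *: z t = dz by move=> <-; rewrite scalerA divff // scale1r.
apply/eqP; rewrite -subr_eq0 -normr_le0; apply/ler_addgt0Pl => e e0.
rewrite addr0.
move: Dz; rewrite -Dzv => /cvgrPdist_le /(_ e e0).
rewrite -/(derive z 0 1) Dzv => -[d /= d0 Hd].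
pose k := Num.truncn (`|t| / d).
have kd : `|t| / k.+1%:R < d.
  rewrite ltr_pdivrMr ?ltr0n // mulrC -ltr_pdivrMr //.
  by have := truncnS_gt (`|t| / d).
have := Hd (t / k.+1%:R).
rewrite /ball_ /= sub0r normrN normrM normfV [`|k.+1%:R|]ger0_norm //.
move=> /(_ kd); rewrite mulf_neq0 ?invr_eq0 ?pnatr_eq0 // => /(_ isT).
rewrite /shift /= addr0 z0 subr0 [_%:A]mulr1.
have := zM k (t / k.+1%:R); rewrite mulrC divfK ?pnatr_eq0 // => ->.
by rewrite distrC scalerA invfM invrK [t^-1 * _]mulrC mulrC.
Qed.

Lemma homog_diff (f : V -> V) : (forall t x, f (t *: x) = t *: f x) ->
  differentiable f 0 -> forall x, f x = 'd f 0 x.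
Proof.
move=> fZ df x.
have H := is_derive_comp (t := 0) _ (is_derive_line x 0).
have {}H := H _ f; rewrite scale0r in H.
apply: is_derive_uniq (H df); under eq_fun do rewrite fZ.
exact: is_derive_line.
Qed.

Definition adj (x y : V) : V := op (op x y) (- x).

Lemma adj_diffr x y : differentiable (adj x) y.
Proof.
have -> : adj x = (fun q : V * V => op q.1 q.2) \o (fun y => (op x y, - x)) by [].
apply: differentiable_comp => //; apply: differentiable_pair => //.
have -> : op x = (fun q : V * V => op q.1 q.2) \o (fun y => (x, y)) by [].
by apply: differentiable_comp => //; apply: differentiable_pair.
Qed.

Lemma op_diffl x y : differentiable (op^~ y) x.
Proof.
have -> : op^~ y = (fun q : V * V => op q.1 q.2) \o (fun x => (x, y)) by [].
by apply: differentiable_comp => //; apply: differentiable_pair.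
Qed.

Lemma adj_diffl x y : differentiable (adj^~ y) x.
Proof.
have -> : adj^~ y = (fun q : V * V => op q.1 q.2) \o (fun x => (op x y, - x)) by [].
apply: differentiable_comp => //; apply: differentiable_pair.
  exact: op_diffl.
exact: differentiableN.
Qed.

Lemma adj_x0 x : adj x 0 = 0.
Proof. by rewrite /adj op_x0 op_xN. Qed.

Lemma adj_0x x : adj 0 x = x.
Proof. by rewrite /adj oppr0 op_x0 op_0x. Qed.

Lemma adj_op x y z : adj x (op y z) = op (adj x y) (adj x z).
Proof. by rewrite /adj !opA op_NK. Qed.

(** Conjugation maps the one-parameter subgroup of [y] to another one, which is a line by
    [one_parameter]. Being homogeneous and differentiable, [adj x] then equals its differential at
    0, whence additivity. *)
Lemma adjZ x t y : adj x (t *: y) = t *: adj x y.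
Proof.
have dz : is_derive (0 : R) 1 (fun t => adj x (t *: y)) ('d (adj x) 0 y).
  have H := is_derive_comp (t := 0) (f := adj x) _ (is_derive_line y 0).
  by rewrite scale0r in H; apply: H; exact: adj_diffr.
have H := one_parameter (z := fun t => adj x (t *: y)) _ dz.
have {}H s : adj x (s *: y) = s *: 'd (adj x) 0 y.
  by apply: H => s' t'; rewrite -op_homog adj_op.
by rewrite H -{2}[y]scale1r H scale1r.
Qed.

Lemma adjE x y : adj x y = 'd (adj x) 0 y.
Proof. by apply: homog_diff => [t z|]; [exact: adjZ|exact: adj_diffr]. Qed.

Lemma adjD x y z : adj x (y + z) = adj x y + adj x z.
Proof. by rewrite !(adjE x) linearD. Qed.

Lemma adj_comp x y z : adj (op x y) z = adj x (adj y z).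
Proof.
have opN a b : - op a b = op (- b) (- a).
  have E : op (op a b) (op (- b) (- a)) = 0 by rewrite opA op_KN op_xN.
  by rewrite -[LHS]op_x0 -E opA op_Nx op_0x.
by rewrite /adj opN !opA.
Qed.

Lemma is_derive_adjr x (g : R -> V) (t : R) dg : is_derive t 1 g dg ->
  is_derive t 1 (fun s => adj x (g s)) (adj x dg).
Proof.
move=> Hg; have H0 := is_derive_comp (@adj_diffr x (g t)) Hg.
apply: (is_derive_eq H0).
have H := is_derive_comp (t := 0) (f := adj x) (g := fun s => g t + s *: dg) (dg := dg).
have {}H := H (@adj_diffr x _).
rewrite scale0r addr0 in H.
apply: is_derive_uniq (H _) _.
  rewrite -[X in is_derive _ _ _ X]add0r.
  by apply: is_deriveD; exact: is_derive_line.
under eq_fun do rewrite adjD adjZ.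
rewrite -[X in is_derive _ _ _ X]add0r.
by apply: is_deriveD; exact: is_derive_line.
Qed.

(** The Lie bracket $[x, y]$, as the derivative of $Ad(\exp(tx))\,y$ at $t = 0$. *)
Definition lbr (x y : V) : V := 'd (adj^~ y) 0 x.

Lemma is_derive_lbr x y : is_derive (0 : R) 1 (fun t => adj (t *: x) y) (lbr x y).
Proof.
have := is_derive_comp (t := 0) (f := adj^~ y) _ (is_derive_line x 0).
by rewrite scale0r; apply; exact: adj_diffl.
Qed.

Lemma lbrDl x x' y : lbr (x + x') y = lbr x y + lbr x' y.
Proof. exact: linearD. Qed.

Lemma lbrZl t x y : lbr (t *: x) y = t *: lbr x y.
Proof. exact: linearZ. Qed.

Lemma lbrDr x y y' : lbr x (y + y') = lbr x y + lbr x y'.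
Proof.
apply: is_derive_uniq (is_derive_lbr _ _) _.
under eq_fun do rewrite adjD.
by apply: is_deriveD; exact: is_derive_lbr.
Qed.

Lemma lbrZr t x y : lbr x (t *: y) = t *: lbr x y.
Proof.
apply: is_derive_uniq (is_derive_lbr _ _) _.
under eq_fun do rewrite adjZ.
by apply: is_deriveZ; exact: is_derive_lbr.
Qed.

Lemma lbrxx x : lbr x x = 0.
Proof.
apply: is_derive_uniq (is_derive_lbr _ _) _.
have E t : adj (t *: x) x = x.
  rewrite /adj -{2}(scale1r x) op_homog -scaleNr op_homog.
  by rewrite addrAC subrr add0r scale1r.
under eq_fun do rewrite E.
exact: is_derive_cst.
Qed.

Lemma is_derive_at (f : R -> V) (t : R) df :
  is_derive (0 : R) 1 (fun s => f (t + s)) df -> is_derive t 1 f df.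
Proof.
move=> Hf; have -> : f = (fun u => f (t + (u - t))).
  by apply/funext => u; rewrite addrC subrK.
have Hu : is_derive t 1 (fun u : R => u - t) 1.
  rewrite -[X in is_derive _ _ _ X]subr0.
  exact: is_deriveB.
have H := is_derive_comp (f := fun s => f (t + s)) _ Hu.
have [/derivable1_diffP d0 v0] := Hf.
rewrite subrr in H; apply: (is_derive_eq (H d0)).
by rewrite -deriveE // v0.
Qed.

Section Nilpotent.
Variable c : nat.
Hypothesis op_nil : forall (xs : seq V) y, size xs = c ->
  foldr (fun x y => op (- y) (adj x y)) y xs = 0.

(** This is [op_nil] with innermost entry [t *: y], differentiated at [t = 0]: there $g^{-1} (x g
    x^{-1})$ has derivative [adj x dg - dg]. *)
Lemma adj_nil (xs : seq V) y : size xs = c ->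
  foldr (fun x y => adj x y - y) y xs = 0.
Proof.
move=> sxs; pose g (xs : seq V) (t : R) := foldr (fun x y => op (- y) (adj x y)) (t *: y) xs.
have [_] : g xs 0 = 0 /\ is_derive (0 : R) 1 (g xs) (foldr (fun x y => adj x y - y) y xs).
  elim: (xs) => [|x ys [IH0 IH]] /=.
    by rewrite /g /= scale0r; split=> //; exact: is_derive_line.
  have E : g (x :: ys) = (fun t => op (- g ys t) (adj x (g ys t))) by [].
  rewrite E IH0 oppr0 adj_x0 op_x0; split=> //.
  rewrite addrC; apply: is_derive_op0; rewrite ?IH0 ?oppr0 ?adj_x0 //.
  exact: is_derive_adjr.
move=> /is_derive_uniq; apply.
have -> : g xs = (fun=> 0) by apply/funext => t; exact: op_nil.
exact: is_derive_cst.
Qed.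

(* The operators [adj x - 1] are replaced by brackets one at a time, starting from
   the innermost, by differentiating [t |-> adj (t *: z) - 1] at [0]. *)
Lemma lbr_nil_mixed (zs xs : seq V) y : (size xs + size zs)%N = c ->
  foldr (fun x y => adj x y - y) (foldr lbr y zs) xs = 0.
Proof.
elim: zs xs => [|z zs IH] xs; first by rewrite addn0; exact: adj_nil.
move=> sxs /=; set w := foldr lbr y zs.
have H t : foldr (fun x y => adj x y - y) (adj (t *: z) w - w) xs = 0.
  by have := IH (rcons xs (t *: z)); rewrite foldr_rcons size_rcons -sxs addSnnS; apply.
have D g dg : is_derive (0 : R) 1 g dg ->
    is_derive (0 : R) 1 (fun t => foldr (fun x y => adj x y - y) (g t) xs)
      (foldr (fun x y => adj x y - y) dg xs).
  move=> Hg; elim: (xs) => [//|x ys IHys] /=.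
  by apply: is_deriveB => //; exact: is_derive_adjr.
apply: is_derive_uniq (D (fun t => adj (t *: z) w - w) _ _) _.
  rewrite -[X in is_derive _ _ _ X]subr0.
  by apply: is_deriveB; exact: is_derive_lbr.
under eq_fun do rewrite H.
exact: is_derive_cst.
Qed.

Lemma nil_bracket_lbr : nil_bracket lbr c.
Proof.
split.
- exact: lbrDl.
- exact: lbrDr.
- by move=> q x y; exact: lbrZl.
- by move=> q x y; exact: lbrZr.
- exact: lbrxx.
- by move=> xs y sxs; apply: (lbr_nil_mixed (xs := [::])).
Qed.

Lemma is_derive_adjl x y (t : R) :
  is_derive t 1 (fun s => adj (s *: x) y) (adj (t *: x) (lbr x y)).
Proof.
apply: is_derive_at.
under eq_fun do rewrite -op_homog adj_comp.
by apply: is_derive_adjr; exact: is_derive_lbr.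
Qed.

(** The identity $Ad(\exp x) = e^{ad x}$: differentiating $Ad(\exp(tx))\,y$ replaces [y] by
    [lbr x y], so the derivatives of order at least [c] vanish. *)
Lemma adj_taylor x y K : (c <= K)%N ->
  adj x y = \sum_(j < K) ratr (j`!%:R^-1) *: iter j (lbr x) y.
Proof.
move=> cK; pose g j (t : R) := adj (t *: x) (iter j (lbr x) y).
have dg j (t : R) : is_derive t 1 (g j) (g j.+1 t) by exact: is_derive_adjl.
have gK t : g K t = 0 by rewrite /g (iter_br_nil nil_bracket_lbr) // adj_x0.
have := taylor_curve dg gK 1; rewrite {1}/g scale1r /= => ->.
by apply: eq_bigr => j _; rewrite /g ?scale0r adj_0x expr1n mul1r fmorphV rmorph_nat.
Qed.

Hypothesis op_C1 : forall Z W : V,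
  (fun h : R => 'D_W (op^~ (- (h *: Z))) (h *: Z)) @ 0 --> W.

(* The right-trivialized differential of the exponential map at [Z]. *)
Definition rho (Z W : V) : V := 'd (op^~ (- Z)) Z W.

Lemma is_derive_rho Z W :
  is_derive (0 : R) 1 (fun s => op (Z + s *: W) (- Z)) (rho Z W).
Proof.
have Hg : is_derive (0 : R) 1 (fun s : R => Z + s *: W) W.
  rewrite -[X in is_derive _ _ _ X]add0r.
  by apply: is_deriveD; exact: is_derive_line.
have := is_derive_comp (f := op^~ (- Z)) _ Hg.
by rewrite scale0r addr0; apply; exact: op_diffl.
Qed.

(** Both factors of $\exp(r(Z+sW)) \exp(r'(Z+sW))$ vary with $s$; moving everything to the right of
    the first factor conjugates the variation of the second. *)
Lemma rho_cocycle Z W (r r' : R) :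
  rho ((r + r') *: Z) ((r + r') *: W) =
  rho (r *: Z) (r *: W) + adj (r *: Z) (rho (r' *: Z) (r' *: W)).
Proof.
apply: is_derive_uniq (is_derive_rho _ _) _.
have E s : op ((r + r') *: Z + s *: ((r + r') *: W)) (- ((r + r') *: Z)) =
  op (op (r *: Z + s *: (r *: W)) (- (r *: Z)))
     (adj (r *: Z) (op (r' *: Z + s *: (r' *: W)) (- (r' *: Z)))).
  have ZE q : q *: Z + s *: (q *: W) = q *: (Z + s *: W).
    by rewrite scalerDr !scalerA mulrC.
  rewrite !ZE -op_homog /adj !opA op_NK -!scaleNr opprD [- r + _]addrC -op_homog.
  by rewrite !opA.
under eq_fun do rewrite E.
apply: is_derive_op0; rewrite ?scale0r ?addr0 ?op_xN ?adj_x0 //.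
- exact: is_derive_rho.
- by apply: is_derive_adjr; exact: is_derive_rho.
Qed.

Lemma rhoZ Z (a : R) W : rho Z (a *: W) = a *: rho Z W.
Proof. exact: linearZ. Qed.

(** The cocycle identity reduces the derivative at [r] to the one at 0. There the difference
    quotient is [rho (h *: Z) W], and its limit [W] is the continuity expressed by [op_C1]. *)
Lemma is_derive_rho_line Z W (r : R) :
  is_derive r 1 (fun r => rho (r *: Z) (r *: W)) (adj (r *: Z) W).
Proof.
have D0 : is_derive (0 : R) 1 (fun r => rho (r *: Z) (r *: W)) W.
  have E h : h != 0 -> h^-1 *: (((fun r => rho (r *: Z) (r *: W)) \o shift 0) (h *: (1 : R)) -
      rho (0 *: Z) (0 *: W)) = 'D_W (op^~ (- (h *: Z))) (h *: Z).
    move=> h0; rewrite /shift /= addr0 [_%:A]mulr1 !rhoZ !scale0r subr0.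
    by rewrite scalerA mulVf // scale1r deriveE //; exact: op_diffl.
  have H : (fun h : R => h^-1 *: (((fun r => rho (r *: Z) (r *: W)) \o shift 0) (h *: (1 : R)) -
      rho (0 *: Z) (0 *: W))) @ 0^' --> W.
    apply: (@cvg_trans _ ((fun h : R => 'D_W (op^~ (- (h *: Z))) (h *: Z)) @ 0^')).
      apply: near_eq_cvg; near=> h; rewrite E //.
      by near: h; exact: nbhs_dnbhs_neq.
    exact: cvg_within_filter (@op_C1 Z W).
  apply: DeriveDef; first by apply/cvg_ex; exists W.
  by apply: cvg_lim => //; exact: norm_hausdorff.
apply: is_derive_at.
under eq_fun do rewrite rho_cocycle.
rewrite -[X in is_derive _ _ _ X]add0r.
apply: is_deriveD; exact: is_derive_adjr.
Unshelve. all: by end_near. Qed.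

(** The series of $(e^{ad Z} - 1)/ad Z$, that is, the integral of $Ad(\exp(rZ))\,W$ over $[0,1]$.
    The Taylor term of index 0 is [rho 0 0 = 0], hence the shifted factorials. *)
Lemma rhoE Z W K : (c <= K)%N ->
  rho Z W = \sum_(j < K) ratr (j.+1`!%:R^-1) *: iter j (lbr Z) W.
Proof.
move=> cK; pose g j (t : R) := if j is i.+1 then adj (t *: Z) (iter i (lbr Z) W)
  else rho (t *: Z) (t *: W).
have dg j (t : R) : is_derive t 1 (g j) (g j.+1 t).
  by case: j => [|j]; [exact: is_derive_rho_line|exact: is_derive_adjl].
have gK t : g K.+1 t = 0 by rewrite /g (iter_br_nil nil_bracket_lbr) // adj_x0.
have := taylor_curve dg gK 1.
have rho0 : rho 0 0 = 0 by have := rhoZ 0 0 0; rewrite !scale0r.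
rewrite {1}/g !scale1r big_ord_recl /= !scale0r rho0 scaler0 add0r => ->.
by apply: eq_bigr => j _; rewrite /g ?scale0r adj_0x expr1n mul1r fmorphV rmorph_nat.
Qed.

Lemma is_derive_lbr2 (g h : R -> V) (t : R) dg dh :
  is_derive t 1 g dg -> is_derive t 1 h dh ->
  is_derive t 1 (fun s => lbr (g s) (h s)) (lbr (g t) dh + lbr dg (h t)).
Proof.
move=> Hg Hh; pose b i j := lbr (delta_mx 0 i) (delta_mx 0 j).
have E x y : lbr x y = \sum_i \sum_j (x 0 i * y 0 j) *: b i j.
  have El (I : Type) (r : seq I) (F : I -> V) : lbr (\sum_(i <- r) F i) y =
      \sum_(i <- r) lbr (F i) y.
    by rewrite /lbr; exact: linear_sum.
  have Er x' (I : Type) (r : seq I) (F : I -> V) : lbr x' (\sum_(i <- r) F i) =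
      \sum_(i <- r) lbr x' (F i).
    apply: (big_morph (lbr x')); first exact: lbrDr.
    by have := lbrZr 0 x' 0; rewrite !scale0r.
  rewrite [in LHS](row_sum_delta x) El; apply: eq_bigr => i _.
  rewrite [in LHS](row_sum_delta y) Er; apply: eq_bigr => j _.
  by rewrite lbrZl lbrZr scalerA.
under eq_fun do rewrite E.
rewrite !E -big_split.
apply: is_derive_bigsum => i; rewrite -big_split /=.
apply: is_derive_bigsum => j; rewrite /= -scalerDl; apply: is_derive_scalev.
have := is_deriveM (is_derive_coord i Hg) (is_derive_coord j Hh).
by move/is_derive_eq; apply; rewrite /GRing.scale /= [dg _ _ * _]mulrC.
Qed.

Lemma is_derive_evs (P f : seq (rat * btree)) x (z : R -> V) :
  (forall t : R, is_derive t 1 z (evs lbr P x (z t))) ->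
  forall t : R, is_derive t 1 (fun t => evs lbr f x (z t)) (evs lbr (fderiv P f) x (z t)).
Proof.
move=> Hz t; have Hc := nil_bracket_lbr.
have Hw w : is_derive t 1 (fun t => ev lbr w x (z t)) (evs lbr (wderiv P w) x (z t)).
  elim: w => [||u Hu v Hv] /=; [by rewrite evs_nil; exact: is_derive_cst|exact: Hz|].
  rewrite evs_cat (evs_fmap_brl Hc) (evs_fmap_brr Hc) addrC.
  exact: is_derive_lbr2.
rewrite /fderiv; elim: f => [|p f IH].
  by rewrite evs_nil; under eq_fun do rewrite evs_nil; exact: is_derive_cst.
rewrite /= evs_cat evs_scale; under eq_fun do rewrite evs_cons.
by apply: is_deriveD => //; exact: is_deriveZ.
Qed.

(** Taylor coefficients of $\log(\exp(tx)\exp(y))$ at $t = 0$: order 1 without its leading [x], then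
    the orders [k.+2]. Order 0 is [y]. *)
Definition bch_tail (K : nat) : seq (rat * btree) :=
  velocity_tail c ++
  flatten [seq fscale (k.+2`!%:R^-1) (iter k (fderiv (velocity c))
             (fderiv (velocity c) (velocity c))) | k <- iota 0 K].

Lemma allBr_bch_tail K : allBr (bch_tail K).
Proof.
rewrite /bch_tail /allBr all_cat; apply/andP; split.
  exact: allBr_velocity_tail.
rewrite all_flatten_map; apply/allP => k _; rewrite -/(allBr _) allBr_scale.
elim: k => [|k IH] /=; last exact: allBr_fderiv.
by rewrite /fderiv /=; apply/allBr_fderiv/allBr_velocity_tail.
Qed.

(* The curve [z t = op (t *: x) y] satisfies [rho (z t) (z' t) = x]; inverting the
   series of [rho] expresses [z'], and then all its derivatives, by bracket words in
   [x] and [z t]. The [k]-th derivative has only words with at least [k] letters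
   [x], so that the Taylor expansion of [z] at [0] is finite. *)
Lemma op_bch_tail x y : op x y = x + y + evs lbr (bch_tail (2 ^ c)) x y.
Proof.
have Hc := nil_bracket_lbr.
pose z (t : R) := op (t *: x) y.
have Hz (t : R) : is_derive t 1 z (evs lbr (velocity c) x (z t)).
  pose dz := 'd (fun q : V * V => op q.1 q.2) (t *: x, y) (x, 0).
  have Dz : is_derive t 1 z dz.
    exact: (is_derive_op (is_derive_line x t) (is_derive_cst y (t : R) 1)).
  suff <- : dz = evs lbr (velocity c) x (z t) by [].
  apply: evs_velocity => //; rewrite -(rhoE _ _ (leqnSn c)).
  apply: is_derive_uniq (is_derive_line x 0) _.
  have Dzt : is_derive (0 : R) 1 (fun s => z (t + s)) dz.
    have Ht : is_derive (0 : R) 1 (fun s : R => t + s) 1.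
      by rewrite -[X in is_derive _ _ _ X]add0r; exact: is_deriveD.
    have H := is_derive_comp (f := z) _ Ht.
    have [/derivable1_diffP d0 v0] := Dz.
    rewrite addr0 in H; apply: (is_derive_eq (H d0)).
    by rewrite -deriveE // v0.
  have E s : s *: x = op (z (t + s)) (- z t).
    rewrite /z addrC -op_homog -!opA.
    by rewrite !opA -[op (op (s *: x) (t *: x)) y]opA op_KN.
  under eq_fun do rewrite E.
  have := is_derive_comp (f := op^~ (- z t)) _ Dzt.
  by rewrite addr0; apply; exact: op_diffl.
pose P k := iter k (fderiv (velocity c)) [:: (1, LY)].
have E0 u v : evs lbr (P 0%N) u v = v.
  by rewrite evs_cons evs_nil addr0 rmorph1 scale1r.
have dg k (t : R) : is_derive t 1 (fun t => evs lbr (P k) x (z t))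
    (evs lbr (P k.+1) x (z t)).
  exact: (is_derive_evs (P := velocity c)).
have gK t : evs lbr (P (2 ^ c).+2) x (z t) = 0.
  have ck : (2 ^ c < (2 ^ c).+2)%N by [].
  apply: (evs_allX Hc x (z t) ck).
  elim: _.+2 => [|k IH] //=.
  by apply: allX_fderiv => //; exact: allX_velocity.
have := taylor_curve dg gK 1.
rewrite E0 /z scale1r scale0r op_0x => ->.
rewrite big_ord_recl E0 big_ord_recl !expr1n.
rewrite -[evs lbr (P (lift ord0 ord0))]/(evs lbr (P 1%N)).
rewrite (_ : 0`! = 1%N) // (_ : (lift ord0 ord0)`! = 1%N) // divr1 !scale1r.
have P1 : P 1%N = fscale 1 (velocity c) by rewrite /P /= /fderiv /= cats0.
have P1E : P 1%N = velocity c.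
  rewrite P1 /fscale -[RHS]map_id; apply: eq_map => -[q w] /=.
  by rewrite mul1r.
rewrite P1E {1}/velocity evs_cons rmorph1 scale1r.
rewrite /bch_tail evs_cat -!addrA [LHS]addrCA; congr (_ + (_ + (_ + _))).
rewrite evs_flatten (_ : iota 0 (2 ^ c) = index_iota 0 (2 ^ c)); last first.
  by rewrite /index_iota subn0.
rewrite big_mkord; apply: eq_bigr => k _.
rewrite evs_scale expr1n div1r fmorphV rmorph_nat; congr (_ *: evs _ _ _ _).
have -> : fderiv (velocity c) (velocity c) = P 2 by rewrite -{2}P1E.
by rewrite /P -iterD addn2.
Qed.

Lemma analytic_bch_law : bch_law lbr c op (bch_tail (2 ^ c)).
Proof.
split.
- exact: nil_bracket_lbr.
- exact: allBr_bch_tail.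
- exact: op_bch_tail.
- exact: opA.
- by move=> x y; rewrite -/(adj x y); apply: adj_taylor; lia.
Qed.

End Nilpotent.
End AnalyticGroup.

Section DiffApp.
Variables (R : realType) (U V W : normedModType R).

Lemma diff_comp_app (f : U -> V) (g : V -> W) x v :
  differentiable f x -> differentiable g (f x) ->
  'd (g \o f) x v = 'd g (f x) ('d f x v).
Proof. by move=> df dg; rewrite diff_comp. Qed.

Lemma diff_pair_cst (f : U -> V) (w : W) x v : differentiable f x ->
  'd (fun x => (f x, w)) x v = ('d f x v, 0).
Proof. by move=> df; rewrite diff_pair // diff_cst. Qed.

End DiffApp.

(** * From the chart of a Lie group to exponential coordinates *)

Section ChartMul.
Variables (R : realType) (n : nat).
Local Notation V := 'rV[R]_n.
Variables (e l : V -> V) (mu : V * V -> V).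
Hypothesis e_diff : forall x, differentiable e x.
Hypothesis l_diff : forall x, differentiable l x.
Hypothesis leK : forall x, l (e x) = x.
Hypothesis is_derive_e0 : forall x, is_derive (0 : R) 1 (fun t : R => e (t *: x)) x.

Lemma diff_exp0 x : 'd e 0 x = x.
Proof.
have H := is_derive_comp (t := 0) (f := e) _ (is_derive_line x 0).
rewrite scale0r in H; exact: is_derive_uniq (H (e_diff 0)) (is_derive_e0 x).
Qed.

Lemma diff_log0 x : 'd l (e 0) x = x.
Proof.
have H := is_derive_comp (t := 0) (f := l) _ (is_derive_e0 x).
rewrite scale0r in H; apply: is_derive_uniq (H (l_diff _)) _.
under eq_fun do rewrite leK.
exact: is_derive_line.
Qed.

Lemma derive_log (f : V -> V) x : differentiable f 0 ->
  'D_x (f \o l) (e 0) = 'd f 0 x.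
Proof.
move=> df; have df' : differentiable f (l (e 0)) by rewrite leK.
have dfl := differentiable_comp (l_diff (e 0)) df'.
rewrite (deriveE x dfl) [LHS](diff_comp_app x (l_diff _) df').
have D p q : p = 0 -> q = x -> 'd f p q = 'd f 0 x by move=> -> ->.
by apply: D; [exact: leK|exact: diff_log0].
Qed.

Lemma derive_exp_log (f : V -> V) x : differentiable f 0 -> f 0 = 0 ->
  'D_x (e \o (f \o l)) (e 0) = 'd f 0 x.
Proof.
move=> df f0; have df' : differentiable f (l (e 0)) by rewrite leK.
have dfl := differentiable_comp (l_diff (e 0)) df'.
have defl := differentiable_comp dfl (e_diff _).
rewrite (deriveE x defl) [LHS](diff_comp_app x dfl (e_diff _)).
have D p q : p = 0 -> q = 'd f 0 x -> 'd e p q = 'd f 0 x.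
  by move=> -> ->; exact: diff_exp0.
exact: D (etrans (congr1 f (leK 0)) f0)
  (etrans (esym (deriveE x dfl)) (derive_log x df)).
Qed.

Hypothesis e_C1 : forall w x, differentiable ('D_w e) x.
Hypothesis mu_diff : forall q, differentiable mu q.
Hypothesis mu_C1 : forall v q, differentiable ('D_v mu) q.
Hypothesis mu_eN : forall x, mu (e x, e (- x)) = e 0.
Hypothesis mu_e0 : forall p, mu (p, e 0) = p.

Lemma diff_mul0 x : 'd mu (e 0, e 0) (x, 0) = x.
Proof.
have Hx : is_derive (0 : R) 1 (fun t : R => e 0 + t *: x) x.
  rewrite -[X in is_derive _ _ _ X]add0r.
  by apply: is_deriveD; exact: is_derive_line.
have H := is_derive_comp (f := mu) _ (is_derive_pair Hx (is_derive_cst (e 0) (0 : R) 1)).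
rewrite scale0r addr0 in H; apply: is_derive_uniq (H (mu_diff _)) _.
by under eq_fun do rewrite mu_e0.
Qed.

(** The differential of [l] at [e 0] is the identity, which leaves a derivative of [mu] in a
    direction that moves with [h]. Expanding this direction in the standard basis gives derivatives
    in fixed directions, whose continuity follows from smoothness. *)
Lemma chart_mul_C1 Z W :
  (fun h : R => 'D_W (fun x => l (mu (e x, e (- (h *: Z))))) (h *: Z)) @ 0 --> W.
Proof.
pose b (i : 'I_n) : V := delta_mx 0 i.
have E h : 'D_W (fun x => l (mu (e x, e (- (h *: Z))))) (h *: Z) =
    \sum_i ('D_W e (h *: Z)) 0 i *: 'D_((b i, 0)) mu (e (h *: Z), e (- (h *: Z))).
  have dp : differentiable (fun x => (e x, e (- (h *: Z)))) (h *: Z).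
    exact: differentiable_pair.
  have dmu : differentiable (mu \o (fun x => (e x, e (- (h *: Z))))) (h *: Z).
    exact: differentiable_comp.
  rewrite -[X in 'D_W X _]/(l \o (mu \o (fun x => (e x, e (- (h *: Z)))))).
  rewrite deriveE; last exact: differentiable_comp.
  rewrite [LHS](diff_comp_app W dmu (l_diff _)).
  rewrite [X in 'd l _ X](diff_comp_app W dp (mu_diff _)).
  rewrite [X in 'd l X _]mu_eN [LHS]diff_log0.
  rewrite (diff_pair_cst _ _ (e_diff _)) -(deriveE W (e_diff _)).
  rewrite {1}[in LHS](row_sum_delta ('D_W e (h *: Z))).
  have -> : (\sum_j 'D_W e (h *: Z) 0 j *: delta_mx 0 j, 0) =
     \sum_j 'D_W e (h *: Z) 0 j *: (b j, 0) :> V * V.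
    elim: (index_enum _) => [|j r IH]; first by rewrite !big_nil.
    by rewrite !big_cons -IH [RHS]surjective_pairing /= scaler0 addr0.
  rewrite linear_sum; apply: eq_bigr => j _.
  by rewrite linearZ /= -deriveE.
under eq_fun do rewrite E.
pose g (h : R) := \sum_i ('D_W e (h *: Z)) 0 i *:
  'D_((b i, 0)) mu (e (h *: Z), e (- (h *: Z))).
have EW : W = g 0.
  rewrite /g scale0r oppr0 [LHS](row_sum_delta W) deriveE // diff_exp0.
  by apply: eq_bigr => i _; rewrite deriveE // diff_mul0.
suff H : g @ 0 --> g 0 by exact: (eq_ind_r (fun w => g @ 0 --> w) H EW).
rewrite /g.
elim: (index_enum _) => [|i r IH].
  under eq_fun do rewrite big_nil; rewrite big_nil; exact: cvg_cst.
under eq_fun do rewrite big_cons; rewrite big_cons; apply: cvgD => //.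
have dZ (t : R) : differentiable (fun h : R => h *: Z) t by case: (is_diff_scalel t Z).
have De : differentiable (fun h : R => 'D_W e (h *: Z)) 0.
  have H : differentiable ('D_W e) (0 *: Z) by exact: e_C1.
  exact: (differentiable_comp (dZ 0) H).
apply: cvgZ.
  have := differentiable_continuous (differentiable_comp De (differentiable_coord _ 0 i)).
  exact.
have Dmu : differentiable (fun h : R => 'D_((b i, 0)) mu (e (h *: Z), e (- (h *: Z)))) 0.
  have H : differentiable ('D_((b i, 0)) mu) (e (0 *: Z), e (- (0 *: Z))).
    exact: mu_C1.
  have Hp : differentiable (fun h : R => (e (h *: Z), e (- (h *: Z)))) 0.
    apply: differentiable_pair; first exact: (differentiable_comp (dZ 0)).
    have dN : differentiable (fun h : R => - (h *: Z)) 0 by exact: differentiableN.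
    exact: (differentiable_comp dN).
  exact: (differentiable_comp Hp H).
exact: (differentiable_continuous Dmu).
Qed.

End ChartMul.

Section LieGroupBch.
Variables (R : realType) (n : nat) (N : lieGroup R n).
Local Notation V := 'rV[R]_n.
Variables (exp : V -> N) (log : N -> V).
Hypothesis exp_log : is_exp_log exp log.

Definition log_mul (x y : V) : V := log (exp x * exp y)%g.

Let expK : cancel exp log. Proof. by case: exp_log. Qed.
Let logK : cancel log exp. Proof. by case: exp_log. Qed.
Let e (x : V) : V := chart (exp x).
Let l (p : V) : V := log (unchart N p).
Let mu (q : V * V) : V := chart (unchart N q.1 * unchart N q.2)%g.

Let expD x (s t : R) : exp ((s + t) *: x) = (exp (s *: x) * exp (t *: x))%g.
Proof. by case: exp_log => H _ _ _ _; have [] := H x. Qed.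

Let is_derive_e0 x : is_derive (0 : R) 1 (fun t : R => e (t *: x)) x.
Proof. by case: exp_log => H _ _ _ _; have [] := H x. Qed.

Lemma exp_0 : exp 0 = 1%g.
Proof.
have := expD 0 0 0; rewrite !scaler0 => /(congr1 (mulg (exp 0)^-1)).
by rewrite mulKg mulVg.
Qed.

Lemma exp_N x : exp (- x) = (exp x)^-1%g.
Proof.
have E := expD x 1 (-1).
rewrite subrr scale0r exp_0 scale1r scaleN1r in E.
by rewrite -[RHS]mulg1 E mulKg.
Qed.

Lemma exp_log_mul x y : exp (log_mul x y) = (exp x * exp y)%g.
Proof. exact: logK. Qed.

Lemma log_mulA : associative log_mul.
Proof. by move=> x y z; rewrite /log_mul !logK mulgA. Qed.

Lemma log_mul_homog s t x : log_mul (s *: x) (t *: x) = (s + t) *: x.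
Proof. by rewrite /log_mul -expD expK. Qed.

Let e_diff x : differentiable e x.
Proof. by case: exp_log => _ _ _ H _; exact: (H [::]). Qed.

Let l_diff p : differentiable l p.
Proof. by case: exp_log => _ _ _ _ H; exact: (H [::]). Qed.

Let mu_diff q : differentiable mu q.
Proof. exact: (smooth_mul N [::]). Qed.

Let leK x : l (e x) = x.
Proof. by rewrite /l /e chartK expK. Qed.

Let mu_log_mul x y : log_mul x y = l (mu (e x, e y)).
Proof. by rewrite /l /mu /e /= !chartK. Qed.

Lemma log_mul_diff p : differentiable (fun q : V * V => log_mul q.1 q.2) p.
Proof.
have -> : (fun q : V * V => log_mul q.1 q.2) =
    l \o (mu \o (fun q : V * V => (e q.1, e q.2))).
  by apply/funext => q; rewrite mu_log_mul.
apply: differentiable_comp => //; apply: differentiable_comp => //.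
have H1 : differentiable (fun q : V * V => q.1) p.
  by apply: linear_differentiable => q; exact: cvg_fst.
have H2 : differentiable (fun q : V * V => q.2) p.
  by apply: linear_differentiable => q; exact: cvg_snd.
by apply: differentiable_pair; [exact: (differentiable_comp H1)|exact: (differentiable_comp H2)].
Qed.

Lemma log_mul_C1 Z W :
  (fun h : R => 'D_W (log_mul^~ (- (h *: Z))) (h *: Z)) @ 0 --> W.
Proof.
have -> : log_mul = (fun x y => l (mu (e x, e y))).
  by apply/funext => x; apply/funext => y; exact: mu_log_mul.
apply: chart_mul_C1 => //.
- by case: exp_log => _ _ _ H _ w x; exact: (H [:: w] x).
- by move=> v q; exact: (smooth_mul N [:: v] q).
- by move=> x; rewrite /mu /e /= !chartK exp_N mulgV exp_0.
- by move=> p; rewrite /mu /e /= chartK exp_0 mulg1 unchartK.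
Qed.

Lemma exp_adj x y : exp (adj log_mul x y) = (exp x * exp y * (exp x)^-1)%g.
Proof. by rewrite /adj !exp_log_mul exp_N. Qed.

Lemma log_mul_nil c : @lower_central N c = [set 1%g] ->
  forall (xs : seq V) y, size xs = c ->
    foldr (fun x y => log_mul (- y) (adj log_mul x y)) y xs = 0.
Proof.
move=> Nc xs y sxs; rewrite -[LHS]expK -[RHS]expK; congr log.
suff H : @lower_central N (size xs) (exp (foldr (fun x y => log_mul (- y) (adj log_mul x y)) y xs)).
  by rewrite sxs Nc in H; rewrite H exp_0.
elim: xs {sxs} => [//|x xs IH] /= H _; apply.
(* The commutator of $g$ and $h$ is $g^{-1} h^{-1} g h$; taking $h = x^{-1}$ turns it into $g^{-1} x
   g x^{-1}$. *)
exists (exp (foldr (fun x y => log_mul (- y) (adj log_mul x y)) y xs)), (exp x)^-1%g.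
split => //.
by rewrite exp_log_mul exp_adj exp_N commgEl conjgE invgK !mulgA.
Qed.

Lemma AdE x y : Ad x y = adj log_mul (log x) y.
Proof.
rewrite /Ad.
have -> : (fun q : V => chart (x * unchart N q * x^-1)%g) = e \o (adj log_mul (log x) \o l).
  by apply/funext => q; rewrite /e /l /= exp_adj !logK.
have E : chart (1%g : N) = e 0 by rewrite /e exp_0.
have da := @adj_diffr _ _ _ log_mul_diff (log x).
rewrite E (adjE log_mulA log_mul_homog log_mul_diff).
by apply: derive_exp_log => //; exact: (adj_x0 log_mul_homog).
Qed.

(** The chart and the exponential coordinates are related by [e] and [l], whose differentials at the
    identity of the group are the identity map. *)
Lemma lie_bracketE : lie_bracket N = lbr log_mul.
Proof.
apply/funext => x; apply/funext => y; rewrite /lie_bracket.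
have -> : (fun p : V => Ad (unchart N p) y) = adj log_mul ^~ y \o l.
  by apply/funext => p; rewrite AdE.
have E : chart (1%g : N) = e 0 by rewrite /e exp_0.
have da := @adj_diffl _ _ _ log_mul_diff.
by rewrite E; exact: derive_log.
Qed.

Lemma lie_group_bch : nilpotent_group N ->
  exists c s, bch_law (lie_bracket N) c log_mul s.
Proof.
move=> [c Nc]; exists c, (bch_tail c (2 ^ c)); rewrite lie_bracketE.
apply: analytic_bch_law.
- exact: log_mulA.
- exact: log_mul_homog.
- exact: log_mul_diff.
- exact: log_mul_nil.
- exact: log_mul_C1.
Qed.

End LieGroupBch.

(** * Rational coordinates and determinants *)

(** The [k]-th power of the reduced denominator divides [C]. For [k = C] this forces the denominator
    to be 1, since $2^C > C$. *)
Lemma rat_int_of_powers (x : rat) (C : nat) : (0 < C)%N ->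
  (forall k : nat, exists z : int, C%:R * x ^+ k = z%:~R) -> exists z : int, x = z%:~R.
Proof.
move=> C0 H; exists (numq x).
suff d1 : denq x = 1 by rewrite -[LHS]divq_num_den d1 divr1.
have [z Hz] := H C.
have dz0 : (denq x)%:~R != 0 :> rat by rewrite intr_eq0 denq_neq0.
have E : (C%:Z * numq x ^+ C = z * denq x ^+ C)%R.
  apply/eqP; rewrite -(eqr_int rat) !rmorphM !rmorphXn /= -Hz -mulrA -exprMn.
  by rewrite -[in X in _ == X * _]/x numqE.
have dv : (denq x ^+ C %| C%:Z)%Z.
  have : (denq x ^+ C %| C%:Z * numq x ^+ C)%Z by rewrite E dvdz_mull.
  by rewrite Gauss_dvdzl // coprimez_pexpl ?coprimez_pexpr // coprimez_sym coprimezE coprime_num_den.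
have : (`|denq x| ^ C <= C)%N.
  by rewrite -abszX; apply: dvdn_leq => //; have := dv; rewrite /dvdz unfold_in.
case: (leqP `|denq x| 1) => [d1 _|d2].
  have := denq_gt0 x; lia.
have := ltn_expl C d2; lia.
Qed.

Lemma common_denominator m n (Q : 'M[rat]_(m, n)) :
  exists2 D : nat, (0 < D)%N & exists N : 'M[int]_(m, n), D%:R *: Q = map_mx intr N.
Proof.
pose D := (\prod_i \prod_j `|denq (Q i j)|)%N.
exists D; first by do 2 apply: prodn_gt0 => ?; rewrite absz_gt0 denq_neq0.
exists (\matrix_(i, j) (numq (Q i j) * (D %/ `|denq (Q i j)|)%N)).
apply/matrixP => i j; rewrite !mxE rmorphM /= -pmulrn.
have dD : (`|denq (Q i j)| %| D)%N.
  by rewrite /D (bigD1 i) //= (bigD1 j) //= -mulnA dvdn_mulr.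
have E : `|denq (Q i j)|%:R = (denq (Q i j))%:~R :> rat.
  by rewrite pmulrn gez0_abs // ltW.
by rewrite -{1}(divnK dD) natrM E numqE -mulrA [RHS]mulrC [_%:~R * Q i j]mulrC.
Qed.

Section RationalCoordinates.
Variables (R : realType) (V : lmodType R).

Definition lc d (b : 'I_d -> V) (x : 'rV[rat]_d) : V := \sum_i ratr (x 0 i) *: b i.

Section Lc.
Variables (d : nat) (b : 'I_d -> V).

Lemma lcD x y : lc b (x + y) = lc b x + lc b y.
Proof.
rewrite /lc -big_split; apply: eq_bigr => i _ /=.
by rewrite mxE rmorphD scalerDl.
Qed.

Lemma lcZ q x : lc b (q *: x) = ratr q *: lc b x.
Proof.
rewrite /lc scaler_sumr; apply: eq_bigr => i _.
by rewrite mxE rmorphM scalerA.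
Qed.

Lemma lc0 : lc b 0 = 0.
Proof. by rewrite /lc big1 // => i _; rewrite mxE rmorph0 scale0r. Qed.

Lemma lc_delta i : lc b (delta_mx 0 i) = b i.
Proof.
rewrite /lc (bigD1 i) //= mxE !eqxx rmorph1 scale1r big1 ?addr0 // => j /negPf ji.
by rewrite mxE ji andbF rmorph0 scale0r.
Qed.

Lemma Qspan_lc (v : V) : Qspan (range b) v -> exists x, v = lc b x.
Proof.
apply: (@Qspan_ind _ _ (range b) [set v | exists x, v = lc b x]).
- by exists 0; rewrite lc0.
- by move=> _ _ [x ->] [y ->]; exists (x + y); rewrite lcD.
- by move=> q _ [i _ <-]; exists (q *: delta_mx 0 i); rewrite lcZ lc_delta.
Qed.

Lemma lc_Qspan L x : (forall i, Qspan L (b i)) -> Qspan L (lc b x).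
Proof. by move=> HL; apply: Qspan_sum => i _; exact: QspanZ. Qed.

Lemma lc_inj L : Qbasis L b -> injective (lc b).
Proof.
move=> [free _] x y Exy; apply/rowP => i.
have E : lc b (x - y) = 0 by rewrite -scaleN1r lcD lcZ rmorphN1 scaleN1r Exy subrr.
have := free (fun i => (x - y) 0 i) E i.
by rewrite !mxE => /eqP; rewrite subr_eq0 => /eqP.
Qed.

Lemma lc_mulmx d' (b' : 'I_d' -> V) (M : 'M[rat]_(d', d)) x :
  (forall i, b' i = lc b (row i M)) -> lc b' x = lc b (x *m M).
Proof.
move=> Hb'; rewrite /lc; under eq_bigr do rewrite Hb' /lc scaler_sumr.
rewrite exchange_big; apply: eq_bigr => j _.
rewrite mxE rmorph_sum scaler_suml; apply: eq_bigr => i _ /=.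
by rewrite mxE scalerA rmorphM.
Qed.

End Lc.

Lemma Qbasis_exists (L : set V) d (b : 'I_d -> V) : Qspan (range b) = L ->
  exists d' (b' : 'I_d' -> V), Qbasis L b'.
Proof.
elim: d b => [|d IH] b HL; first by exists 0%N, b; split=> // c _ [].
have [free|/existsNP[q /not_implyP[Hq /existsNP[k /eqP qk]]]] :=
  pselect (forall q : 'I_d.+1 -> rat, \sum_i ratr (q i) *: b i = 0 -> forall i, q i = 0).
  by exists d.+1, b.
apply: (IH (fun i => b (lift k i))); rewrite -HL; apply/seteqP; split.
  apply: Qspan_mono => _ [i _ <-]; apply: Qspan_sub.
  by exists (lift k i).
apply: Qspan_mono => _ [i _ <-].
have [j ->|->] := unliftP k i; first by apply: Qspan_sub; exists j.
move: Hq; rewrite (bigD1_ord k) //= => /eqP; rewrite addr_eq0 => /eqP Hk.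
have -> : b k = ratr (q k)^-1 *: (ratr (q k) *: b k).
  by rewrite scalerA -rmorphM mulVf // rmorph1 scale1r.
rewrite Hk; apply/QspanZ/QspanN/Qspan_sum => j _; apply/QspanZ/Qspan_sub.
by exists j.
Qed.

End RationalCoordinates.

Section LinearOnSpan.
Variables (R : realType) (V : lmodType R) (L : set V) (Phi : V -> V).
Hypothesis PhiL : forall x, L x -> L (Phi x).
Hypothesis PhiD : forall x y, L x -> L y -> Phi (x + y) = Phi x + Phi y.
Hypothesis PhiZ : forall q x, L x -> Phi (ratr q *: x) = ratr q *: Phi x.
Variables (d : nat) (b : 'I_d -> V) (M : 'M[rat]_d).
Hypothesis b_basis : Qbasis L b.
Hypothesis PhiM : forall i, Phi (b i) = \sum_(j < d) ratr (M i j) *: b j.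

Lemma basis_mem i : L (b i).
Proof. by case: b_basis => _ <-; apply: Qspan_sub; exists i. Qed.

Lemma lc_mem x : L (lc b x).
Proof. by case: b_basis => _ <-; apply: lc_Qspan => i; apply: Qspan_sub; exists i. Qed.

Lemma lc_surj v : L v -> exists x, v = lc b x.
Proof. by case: b_basis => _ <-; exact: Qspan_lc. Qed.

Lemma Phi_lc x : Phi (lc b x) = lc b (x *m M).
Proof.
have P0 : Phi 0 = 0.
  have L0 : L 0 by rewrite -(lc0 b); exact: lc_mem.
  by have := PhiZ 0 L0; rewrite rmorph0 !scale0r.
have [Lc ->] : L (lc b x) /\ Phi (lc b x) = \sum_i ratr (x 0 i) *: Phi (b i).
  rewrite /lc; elim: (index_enum _) => [|i r [Lr IH]].
    by rewrite !big_nil P0 -(lc0 b); split=> //; exact: lc_mem.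
  rewrite !big_cons; have Li : L (ratr (x 0 i) *: b i).
    by rewrite -(lc_delta b i) -lcZ; exact: lc_mem.
  split; last by rewrite PhiD // PhiZ ?IH //; exact: basis_mem.
  by have [y ->] := lc_surj Li; have [z ->] := lc_surj Lr; rewrite -lcD; exact: lc_mem.
rewrite -[LHS]/(lc (fun i => Phi (b i)) x); apply: lc_mulmx => i.
by rewrite PhiM; apply: eq_bigr => j _; rewrite mxE.
Qed.

Definition mxpow k : 'M[rat]_d := iter k (mulmx^~ M) 1%:M.

Lemma iter_Phi_lc k x : iter k Phi (lc b x) = lc b (x *m mxpow k).
Proof. by elim: k => [|k IH]; rewrite ?mulmx1 //= IH Phi_lc mulmxA. Qed.

Lemma det_mxpow k : \det (mxpow k) = \det M ^+ k.
Proof. by elim: k => [|k IH]; rewrite ?det1 //= det_mulmx IH exprSr. Qed.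

Lemma mxpow_unit k : M \in unitmx -> mxpow k \in unitmx.
Proof. by rewrite !unitmxE det_mxpow => /unitrX; exact. Qed.

Lemma unitmx_surj y : M \in unitmx -> L y -> exists2 x, L x & Phi x = y.
Proof.
move=> uM /lc_surj[z ->]; exists (lc b (z *m invmx M)); first exact: lc_mem.
by rewrite Phi_lc mulmxKV.
Qed.

Lemma inj_unitmx : (forall x, L x -> Phi x = 0 -> x = 0) -> M \in unitmx.
Proof.
move=> Pinj; rewrite -row_free_unit -kermx_eq0; apply/rowV0P => v /sub_kermxP vM.
apply: (lc_inj b_basis); rewrite lc0; apply: Pinj; first exact: lc_mem.
by rewrite Phi_lc vM lc0.
Qed.

End LinearOnSpan.

(** The choice in [Qdet] yields the determinant in some basis; the results below hold for an
    arbitrary basis and so apply to it. *)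
Lemma Qdet_spec (R : realType) (V : lmodType R) (L : set V) (Phi : V -> V) :
  (exists d (b : 'I_d -> V), Qspan (range b) = L) ->
  (forall x, L x -> L (Phi x)) ->
  exists d (b : 'I_d -> V) (M : 'M[rat]_d), [/\ Qbasis L b,
    forall i, Phi (b i) = \sum_(j < d) ratr (M i j) *: b j & Qdet L Phi = \det M].
Proof.
move=> [d0 [b0 /Qbasis_exists[d [b Hb]]]] PhiL.
suff [M HM] : exists M : 'M[rat]_d, forall i, Phi (b i) = \sum_(j < d) ratr (M i j) *: b j.
  by apply: (@xgetPex _ 0 [set D | exists d (b : 'I_d -> V) (M : 'M[rat]_d), [/\ Qbasis L b,
    forall i, Phi (b i) = \sum_(j < d) ratr (M i j) *: b j & D = \det M]]); exists (\det M), d, b, M.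
have H i : exists x, Phi (b i) = lc b x.
  by apply: (lc_surj Hb); apply: PhiL; exact: (basis_mem Hb).
have [f Hf] := choice H; exists (\matrix_i f i) => i.
by rewrite Hf; apply: eq_bigr => j _; rewrite mxE.
Qed.

(** * Determinant and surjectivity on the subgroup *)

Section Malcev.
Variables (R : realType) (V : lmodType R) (br : V -> V -> V) (c : nat).
Variables (op : V -> V -> V) (s : seq (rat * btree)).
Hypothesis Hop : bch_law br c op s.
Variable Gm : set V.
Hypothesis Gm0 : Gm 0.
Hypothesis Gmop : forall x y, Gm x -> Gm y -> Gm (op x y).
Hypothesis GmN : forall x, Gm x -> Gm (- x).
Variable gens : seq V.
Hypothesis gens_Gm : [set` gens] `<=` Gm.
Hypothesis Gm_gen : forall M : set V, M 0 -> (forall x, M x -> M (- x)) ->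
  (forall x y, M x -> M y -> M (op x y)) -> [set` gens] `<=` M -> Gm `<=` M.
Let L := Qspan Gm.

Lemma Gm_lattice : exists d (b : 'I_d -> V), (forall i, L (b i)) /\
  forall x, Gm x -> exists n : 'I_d -> int, x = \sum_i b i *~ n i.
Proof.
have [d [b [Hb [M [M0 MN Mop Mg ML]]]]] := group_lattice Hop gens.
exists d, b; split; last by move=> x /(Gm_gen M0 MN Mop Mg)/ML.
move=> i; have [q [j [v [-> Hv]]]] := Hb i; apply: QspanZ.
elim: Hv => [x /gens_Gm xg|i' j' x y _ Lx _ Ly]; first exact: Qspan_sub.
exact: (Qspan_br Hop).
Qed.

Lemma span_finite : exists d (b : 'I_d -> V), Qspan (range b) = L.
Proof.
have [d [b [Lb Hb]]] := Gm_lattice; exists d, b; apply/seteqP; split.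
  by apply: Qspan_mono => _ [i _ <-]; exact: Lb.
apply: Qspan_mono => x /Hb[n ->]; apply: Qspan_sum => i _.
by apply/QspanMz/Qspan_sub; exists i.
Qed.

Section Endo.
Variable Phi : V -> V.
Hypothesis PhiL : forall x, L x -> L (Phi x).
Hypothesis PhiD : forall x y, L x -> L y -> Phi (x + y) = Phi x + Phi y.
Hypothesis PhiZ : forall q x, L x -> Phi (ratr q *: x) = ratr q *: Phi x.
Hypothesis PhiB : forall x y, L x -> L y -> Phi (br x y) = br (Phi x) (Phi y).
Hypothesis PhiG : forall x, Gm x -> Gm (Phi x).
Variables (d : nat) (b : 'I_d -> V) (M : 'M[rat]_d).
Hypothesis b_basis : Qbasis L b.
Hypothesis PhiM : forall i, Phi (b i) = \sum_(j < d) ratr (M i j) *: b j.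

Lemma Phi_op x y : L x -> L y -> Phi (op x y) = op (Phi x) (Phi y).
Proof.
move=> Lx Ly; rewrite !(bch_op Hop) PhiD ?PhiD //; last first.
- by apply: Qspan_sum => p _; apply: QspanZ; exact: (Qspan_ev Hop).
- exact: QspanD.
congr (_ + _); have P0 : Phi 0 = 0.
  by have := PhiZ 0 (Qspan0 Gm); rewrite rmorph0 !scale0r.
have Le w : L (ev br w x y) by exact: (Qspan_ev Hop).
have Pe w : Phi (ev br w x y) = ev br w (Phi x) (Phi y).
  by elim: w => //= u Hu v Hv; rewrite PhiB // Hu Hv.
rewrite /evs; suff [] : L (\sum_(p <- s) ratr p.1 *: ev br p.2 x y) /\
  Phi (\sum_(p <- s) ratr p.1 *: ev br p.2 x y) =
  \sum_(p <- s) ratr p.1 *: ev br p.2 (Phi x) (Phi y) by [].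
elim: (s) => [|p r [Lr IH]]; first by rewrite !big_nil P0; split; first exact: Qspan0.
have Lp : L (ratr p.1 *: ev br p.2 x y) := QspanZ _ (Le _).
by rewrite !big_cons PhiD // PhiZ // Pe IH; split=> //; exact: QspanD.
Qed.

Lemma iter_PhiG k x : Gm x -> Gm (iter k Phi x).
Proof. by move=> Gx; elim: k => //= k; exact: PhiG. Qed.

Lemma lattice_coord : exists2 D : nat, (0 < D)%N &
  forall x, Gm x -> exists n : 'rV[int]_d, x = lc b (D%:R^-1 *: map_mx intr n).
Proof.
have [d0 [b0 [Lb0 Hb0]]] := Gm_lattice.
have [f Hf] := choice (fun i => lc_surj b_basis (Lb0 i)).
have [D D0 [N HN]] := common_denominator (\matrix_i f i).
exists D => // x /Hb0[n ->]; exists (\row_i n i *m N).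
rewrite map_mxM -HN -scalemxAr scalerA mulVf ?pnatr_eq0 -?lt0n // scale1r.
rewrite -(lc_mulmx (b' := b0)); last by move=> i; rewrite rowK.
by apply: eq_bigr => i _; rewrite !mxE ratr_int scaler_int.
Qed.

Lemma basis_multiple : exists2 K : nat, (0 < K)%N & forall i, Gm (b i *~ K).
Proof.
have H i : exists K : nat, (0 < K)%N /\ Gm (b i *~ K).
  have [K K0 GK] := Qspan_multiple Hop Gm0 Gmop GmN (basis_mem b_basis i).
  by exists `|K|%N; rewrite gtz0_abs // absz_gt0 gt_eqF.
have [f Hf] := choice H.
exists (\prod_i f i)%N; first by apply: prodn_gt0 => i; case: (Hf i).
move=> i; rewrite (bigD1 i) //= PoszM mulrzA.
by apply: (Gm_Mz Hop Gm0 Gmop GmN); case: (Hf i).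
Qed.

(** Every iterate of [Phi] keeps [b i *~ K] in [Gm], hence in the lattice with denominator [D]; so
    [D * K] clears row [i] of every power of [M]. *)
Lemma pow_denominator : exists2 C : nat, (0 < C)%N &
  forall k, exists N : 'M[int]_d, C%:R *: mxpow M k = map_mx intr N.
Proof.
have [D D0 HD] := lattice_coord; have [K K0 HK] := basis_multiple.
exists (D * K)%N; first by rewrite muln_gt0 D0.
move=> k; have H i : exists n : 'rV[int]_d, (D * K)%:R *: row i (mxpow M k) = map_mx intr n.
  have [n Hn] := HD _ (iter_PhiG k (HK i)); exists n.
  have E : b i *~ K = lc b (K%:R *: delta_mx 0 i).
    by rewrite lcZ lc_delta ratr_nat scaler_nat pmulrn.
  rewrite E (iter_Phi_lc PhiD PhiZ b_basis PhiM) in Hn.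
  have := lc_inj b_basis Hn; rewrite -scalemxAl -rowE => /(congr1 (fun v => D%:R *: v)).
  by rewrite !scalerA mulfV ?pnatr_eq0 -?lt0n // scale1r natrM.
have [f Hf] := choice H; exists (\matrix_i f i).
apply/row_matrixP => i; rewrite -map_row rowK -Hf.
by apply/rowP => j; rewrite !mxE.
Qed.

Lemma det_integer : exists z : int, \det M = z%:~R.
Proof.
have [C C0 HC] := pow_denominator.
apply: (@rat_int_of_powers _ (C ^ d)); first by rewrite expn_gt0 C0.
move=> k; have [N HN] := HC k; exists (\det N).
by rewrite -(det_map_mx intr) -HN detZ det_mxpow natrX.
Qed.

(** Preimages of the [b i *~ K] under the [k]-th iterate give an integer matrix $N$ with $N M^k =
    DK$. So the powers of $(\det M)^{-1}$ have a common denominator, and $\det M$ and its inverse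
    are both integers. *)
Lemma det_onto : (forall y, Gm y -> exists2 x, Gm x & Phi x = y) -> `|\det M| = 1.
Proof.
move=> onto; have ontok k y : Gm y -> exists2 x, Gm x & iter k Phi x = y.
  elim: k y => [|k IH] y Gy; first by exists y.
  by have [x /IH[z Gz <-] <-] := onto y Gy; exists z.
have [D D0 HD] := lattice_coord; have [K K0 HK] := basis_multiple.
have H k : exists N : 'M[int]_d, map_mx intr N *m mxpow M k = (D * K)%:R%:M.
  have Hi i : exists n : 'rV[int]_d, map_mx intr n *m mxpow M k = (D * K)%:R *: delta_mx 0 i.
    have [x /HD[n ->]] := ontok k _ (HK i).
    rewrite (iter_Phi_lc PhiD PhiZ b_basis PhiM).
    have -> : b i *~ K = lc b (K%:R *: delta_mx 0 i).
      by rewrite lcZ lc_delta ratr_nat scaler_nat pmulrn.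
    move=> /(lc_inj b_basis) E; exists n; rewrite natrM -scalerA -E -scalemxAl scalerA.
    by rewrite mulfV ?pnatr_eq0 -?lt0n // scale1r.
  have [f Hf] := choice Hi; exists (\matrix_i f i).
  apply/row_matrixP => i; rewrite row_mul -map_row rowK Hf.
  by rewrite rowE mul_mx_scalar.
have C0 : ((D * K)%:R ^+ d != 0 :> rat).
  by rewrite expf_neq0 // pnatr_eq0 -lt0n muln_gt0 D0.
have Hdet k : exists z : int, z%:~R * \det M ^+ k = (D * K)%:R ^+ d.
  have [N HN] := H k; exists (\det N).
  by rewrite -(det_map_mx intr) -det_mxpow -det_mulmx HN det_scalar.
have det0 : \det M != 0.
  have [z Hz] := Hdet 1%N; apply: contra_neq C0 => E.
  by rewrite -Hz E expr1 mulr0.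
have [z Hz] := det_integer.
have [w Hw] : exists w : int, (\det M)^-1 = w%:~R.
  apply: (@rat_int_of_powers _ ((D * K) ^ d)); first by rewrite expn_gt0 muln_gt0 D0 K0.
  move=> k; have [u Hu] := Hdet k; exists u.
  by rewrite natrX -Hu exprVn mulfK // expf_neq0.
have : z * w = 1.
  by apply/eqP; rewrite -(eqr_int rat) rmorphM /= -Hz -Hw mulfV.
move=> /(congr1 absz); rewrite abszM => /eqP; rewrite muln_eq1 => /andP[/eqP z1 _].
by rewrite Hz -intr_norm -abszE z1.
Qed.

Lemma iter_Phi_op k x y : L x -> L y -> iter k Phi (op x y) = op (iter k Phi x) (iter k Phi y).
Proof.
move=> Lx Ly; have LI z : L z -> L (iter k Phi z).
  by move=> Lz; elim: k => //= k; exact: PhiL.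
elim: k LI => //= k IH LI.
have LI' z : L z -> L (iter k Phi z).
  by move=> Lz; elim: (k) => //= k'; exact: PhiL.
by rewrite IH // Phi_op //; exact: LI'.
Qed.

(* The powers of [M] have a bounded denominator; as [\det M] is [1] or [-1], the
   cofactor formula gives the same for their inverses. *)
Lemma backward_lattice : `|\det M| = 1 -> exists2 D : nat, (0 < D)%N &
  forall y, Gm y -> forall k, exists n : 'rV[int]_d,
    iter k Phi (lc b (D%:R^-1 *: map_mx intr n)) = y.
Proof.
move=> detM; have [D D0 HD] := lattice_coord; have [C C0 HC] := pow_denominator.
have uM : M \in unitmx by rewrite unitmxE unitfE -normr_gt0 detM.
exists (D * C ^ d)%N; first by rewrite muln_gt0 D0 expn_gt0 C0.
move=> y /HD[n ->] k; have [N HN] := HC k.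
have uP := mxpow_unit k uM.
have [e He] : exists e : int, (\det (mxpow M k)) * e%:~R = 1.
  have nP : `|\det (mxpow M k)| = 1 by rewrite det_mxpow normrX detM expr1n.
  case: (lerP 0 (\det (mxpow M k))) nP => [/ger0_norm -> ->|/ltr0_norm -> E].
    by exists 1; rewrite mulr1.
  by exists (-1); rewrite rmorphN1 mulrN1 E.
have Cr0 : C%:R != 0 :> rat by rewrite pnatr_eq0 -lt0n.
(* As $N = C M^k$, the product of $adj N$ with $M^k$ is the scalar $C^{-1} C^d \det(M^k)$. The
   factors [C] and [e] turn it into $C^d$, which cancels the enlarged denominator. *)
exists (n *m (C%:Z * e *: \adj N)).
rewrite (iter_Phi_lc PhiD PhiZ b_basis PhiM); congr lc.
have E : \adj (C%:R *: mxpow M k) *m mxpow M k =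
    (C%:R^-1 * (C%:R ^+ d * \det (mxpow M k))) *: 1%:M.
  rewrite -scalerA scalemx1 -detZ -mul_adj_mx -scalemxAr scalerA mulVf //.
  by rewrite scale1r.
rewrite -scalemxAl map_mxM -mulmxA map_mxZ map_mx_adj -HN -scalemxAl E.
rewrite -!scalemxAr mulmx1 !scalerA; congr (_ *: _).
rewrite natrM natrX rmorphM /= -pmulrn.
transitivity (D%:R^-1 * (\det (mxpow M k) * e%:~R)); last by rewrite He mulr1.
have Dr0 : D%:R != 0 :> rat by rewrite pnatr_eq0 -lt0n.
by field; rewrite Cr0 Dr0 expf_neq0.
Qed.

(* The preimages [x k] of [y] under the iterates of [Phi] all lie in one lattice, so
   two of them, [x k] and [x l] with [k < l], lie in the same coset of [Gm]. Applying
   [iter l Phi] exhibits [y] as a product of elements of [Phi @` Gm]. *)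
Lemma det_one_onto : `|\det M| = 1 -> forall y, Gm y -> exists2 x, Gm x & Phi x = y.
Proof.
move=> /backward_lattice[D D0 HD] y Gy; have [n Hn] := choice (HD y Gy).
pose b' i := ratr (D%:R^-1) *: b i.
have Lb' i : L (b' i) by apply: QspanZ; exact: (basis_mem b_basis).
have xE (m : 'rV[int]_d) : lc b (D%:R^-1 *: map_mx intr m) = \sum_i b' i *~ m 0 i.
  apply: eq_bigr => i _.
  by rewrite !mxE rmorphM /= ratr_int mulrC -scalerA scaler_int.
have [K K0 HK] := lattice_coset Hop Gm0 Gmop GmN Lb'.
pose x k := lc b (D%:R^-1 *: map_mx intr (n k)).
have Lx k : L (x k) by exact: (lc_mem b_basis).
have xk k : iter k Phi (x k) = y by exact: Hn.
pose a k i : int := n k 0 i.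
have [k [l [kl Gkl]]] : exists k l, (k < l)%N /\ Gm (op (- x k) (x l)).
  (* Pigeonhole on the coordinate vectors modulo [K]: one more index than there are possible vectors
     of residues. *)
  pose T := {ffun 'I_d -> 'I_(`|K|.+1)}.
  pose r (k : 'I_#|T|.+1) : T := [ffun i => inord (absz (a k i %% K)%Z)].
  have [k [l [kl Ekl]]] : exists k l : 'I_#|T|.+1, (k < l)%N /\ r k = r l.
    have : ~~ injectiveb r.
      by apply: contraT => /negPn/injectiveP/leq_card; rewrite card_ord ltnn.
    move=> /injectivePn[k [l kl Ekl]].
    have [?|] := ltnP k l; first by exists k, l.
    rewrite leq_eqVlt => /orP[/eqP/ord_inj E|?]; last by exists l, k.
    by rewrite E eqxx in kl.
  exists k, l; split=> //.
  have Kn0 : K != 0 by rewrite gt_eqF.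
  have Hmod i : (a k i = a l i %[mod K])%Z.
    have := congr1 (fun f : T => nat_of_ord (f i)) Ekl; rewrite !ffunE !inordK.
    - have H m : (absz (m %% K)%Z = (m %% K)%Z :> int) by rewrite gez0_abs // modz_ge0.
      by move=> /(congr1 Posz); rewrite !H.
    - by rewrite -ltz_nat gez0_abs ?modz_ge0 //; have := ltz_pmod (a l i) K0; lia.
    - by rewrite -ltz_nat gez0_abs ?modz_ge0 //; have := ltz_pmod (a k i) K0; lia.
  pose m i := ((a l i - a k i) %/ K)%Z.
  have Hm i : a l i = a k i + m i * K.
    rewrite /m divzK; first by rewrite addrC subrK.
    by rewrite -eqz_mod_dvd; apply/eqP/esym.
  have := HK (fun i => a k i) m; rewrite /= -big_split /=.
  rewrite /x !xE -/(a _ _); congr (Gm (op _ _)).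
  by apply: eq_bigr => i _; rewrite -/(a l i) Hm mulrzDr.
pose g := op (- x k) (x l).
have xl : x l = op (x k) g by rewrite /g (op_NKl Hop).
have Lg : L g by exact: Qspan_sub.
have := xk l; rewrite {1}xl iter_Phi_op // => yE.
have xkl : iter l Phi (x k) = iter (l - k) Phi y.
  by rewrite -[in RHS](xk k) -iterD subnK // ltnW.
(* Since [k < l], both exponents [l - k] and [l] are positive, and one [Phi] can be pulled out of
   each factor of [y]. *)
have E1 : iter (l - k) Phi y = Phi (iter (l - k).-1 Phi y).
  by rewrite -iterS prednK // subn_gt0.
have E2 : iter l Phi g = Phi (iter l.-1 Phi g).
  by rewrite -iterS prednK // (leq_ltn_trans _ kl).
have Ly z j : L z -> L (iter j Phi z) by move=> Lz; elim: j => //= j; exact: PhiL.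
exists (op (iter (l - k).-1 Phi y) (iter l.-1 Phi g)).
  by apply: Gmop; exact: iter_PhiG.
by rewrite Phi_op -?E1 -?E2 -?xkl //; apply: Ly => //; exact: Qspan_sub.
Qed.

End Endo.
End Malcev.

(** * Extending injective endomorphisms of the group to the Lie algebra *)

Section Extension.
Variables (R : realType) (V : lmodType R) (br : V -> V -> V) (c : nat).
Variables (op : V -> V -> V) (s : seq (rat * btree)).
Hypothesis Hop : bch_law br c op s.
Let Hbr := bch_br Hop.

Let br2 (p q : V * V) : V * V := (br p.1 q.1, br p.2 q.2).
Let op2 (p q : V * V) : V * V := (op p.1 q.1, op p.2 q.2).

Lemma pair_eq (p q : V * V) : p.1 = q.1 -> p.2 = q.2 -> p = q.
Proof. by case: p q => [? ?] [? ?] /= -> ->. Qed.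

Lemma sum_pair (I : Type) (r : seq I) (F : I -> V * V) :
  \sum_(i <- r) F i = (\sum_(i <- r) (F i).1, \sum_(i <- r) (F i).2).
Proof.
elim: r => [|i r IH]; first by rewrite !big_nil.
by rewrite !big_cons IH; apply: pair_eq.
Qed.

(** All operations are componentwise, so [c] and [s] are unchanged. This makes the theory of
    subgroups available for the graph of [psi]. *)
Lemma bch_law_pair : bch_law br2 c op2 s.
Proof.
have Hev w p q : ev br2 w p q = (ev br w p.1 q.1, ev br w p.2 q.2).
  by elim: w => [||u Hu v Hv] /=; [case: p|case: q|rewrite Hu Hv].
have Hit k p q : iter k (br2 p) q = (iter k (br p.1) q.1, iter k (br p.2) q.2).
  by elim: k => [|k IH] /=; [case: q|rewrite IH].
split.
- split.
  + by move=> x x' y; apply: pair_eq; exact: (brDl Hbr).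
  + by move=> x y y'; apply: pair_eq; exact: (brDr Hbr).
  + by move=> q x y; apply: pair_eq; exact: (brZl Hbr).
  + by move=> q x y; apply: pair_eq; exact: (brZr Hbr).
  + by move=> x; apply: pair_eq; exact: (brxx Hbr).
  + move=> xs y sxs.
    have -> : foldr br2 y xs = (foldr br y.1 (map fst xs), foldr br y.2 (map snd xs)).
      by elim: xs {sxs} => [|x xs IH] /=; [case: y|rewrite IH].
    by rewrite !(br_nil Hbr) ?size_map.
- exact: (bch_isBr Hop).
- move=> x y; rewrite /op2 !(bch_op Hop) /evs sum_pair.
  by apply: pair_eq => /=; congr (_ + _); apply: eq_bigr => p _; rewrite Hev.
- by move=> x y z; rewrite /op2 /= !(bch_opA Hop).
- move=> x y; rewrite sum_pair; apply: pair_eq => /=; rewrite (bch_conj Hop);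
    by apply: eq_bigr => j _; rewrite Hit.
Qed.

Variable Gm : set V.
Hypothesis Gm0 : Gm 0.
Hypothesis Gmop : forall x y, Gm x -> Gm y -> Gm (op x y).
Hypothesis GmN : forall x, Gm x -> Gm (- x).
Let L := Qspan Gm.
Hypothesis span_fin : exists d (b : 'I_d -> V), Qspan (range b) = L.
Variable psi : V -> V.
Hypothesis psiG : forall x, Gm x -> Gm (psi x).
Hypothesis psi_op : forall x y, Gm x -> Gm y -> psi (op x y) = op (psi x) (psi y).
Hypothesis psi_inj : forall x y, Gm x -> Gm y -> psi x = psi y -> x = y.

(* The span of the graph of [psi] is again a graph, because each of its elements
   has a multiple in the graph of [psi]. *)
Lemma hom_extension : exists Phi : V -> V,
  Qlie_automorphism br L Phi /\ forall x, Gm x -> Phi x = psi x.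
Proof.
have psi0 : psi 0 = 0.
  have := psi_op Gm0 Gm0; rewrite (op0r Hop) => /(congr1 (op (- psi 0))).
  by rewrite (op_Kl Hop) (opNx Hop) => /esym.
have psiN x : Gm x -> psi (- x) = - psi x.
  move=> Gx; have := psi_op Gx (GmN Gx).
  rewrite (opxN Hop) psi0 => /(congr1 (op (- psi x))).
  by rewrite (op_Kl Hop) (op0r Hop) => /esym.
pose G2 : set (V * V) := [set p | Gm p.1 /\ p.2 = psi p.1].
have G20 : G2 0 by split=> //=; rewrite psi0.
have G2op x y : G2 x -> G2 y -> G2 (op2 x y).
  by move=> [Gx xE] [Gy yE]; split; [exact: Gmop|rewrite /= xE yE psi_op].
have G2N x : G2 x -> G2 (- x).
  by move=> [Gx xE]; split; [exact: GmN|rewrite /= xE psiN].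
have HL2 := Qspan_multiple bch_law_pair G20 G2op G2N.
have B2 := Qspan_br bch_law_pair G20 G2op G2N.
pose L2 := Qspan G2.
have L2L p : L2 p -> L p.1 /\ L p.2.
  apply: (@Qspan_ind _ _ G2 [set p | L p.1 /\ L p.2]).
  - by split; exact: Qspan0.
  - by move=> v w [? ?] [? ?]; split; exact: QspanD.
  - by move=> q v [Gv vE]; split; apply/QspanZ/Qspan_sub; rewrite // vE; exact: psiG.
have LL2 x : L x -> exists y, L2 (x, y).
  apply: (@Qspan_ind _ _ Gm [set x | exists y, L2 (x, y)]).
  - by exists 0; exact: Qspan0.
  - by move=> v w [v' Hv] [w' Hw]; exists (v' + w'); exact: (QspanD Hv Hw).
  - move=> q v Gv; exists (ratr q *: psi v).
    by apply: (@QspanZ _ _ G2 q (v, psi v)); exact: Qspan_sub.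
have mulz_eq0 (v : V) (K : int) : 0 < K -> v *~ K = 0 -> v = 0.
  move=> K0; rewrite -scaler_int => /eqP.
  by rewrite scaler_eq0 intr_eq0 gt_eqF //= => /eqP.
have pairMz (x y : V) (K : int) : (x, y) *~ K = (x *~ K, y *~ K).
  have H (k : nat) : (x, y) *+ k = (x *+ k, y *+ k).
    by elim: k => [|k IH]; rewrite ?mulr0n // !mulrS IH.
  by case: K => k; rewrite ?NegzE ?mulrNz -!pmulrn H.
have L20 y : L2 (0, y) -> y = 0.
  move=> /HL2[K K0]; rewrite pairMz => -[_ /=]; rewrite mul0rz psi0.
  exact: mulz_eq0.
have L2x0 x : L2 (x, 0) -> x = 0.
  move=> /HL2[K K0]; rewrite pairMz => -[/= Gx]; rewrite mul0rz => E.
  by apply: (mulz_eq0 _ K) => //; apply: psi_inj => //; rewrite -E psi0.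
have L2B p q : L2 p -> L2 q -> L2 (p - q).
  by move=> Hp Hq; apply: QspanD => //; exact: QspanN.
have L2fun x y y' : L2 (x, y) -> L2 (x, y') -> y = y'.
  move=> Hy Hy'; apply/eqP; rewrite -subr_eq0; apply/eqP/L20.
  have := L2B _ _ Hy Hy'; congr L2; apply: pair_eq => //=; exact: subrr.
pose Phi x := xget 0 [set y | L2 (x, y)].
have PhiP x : L x -> L2 (x, Phi x) by move=> /LL2; exact: (@xgetPex _ 0 [set y | L2 (x, y)]).
have PhiE x y : L2 (x, y) -> Phi x = y.
  by move=> Hxy; apply: (L2fun x) => //; apply: PhiP; exact: (L2L _ Hxy).1.
have PhiL x : L x -> L (Phi x) by move=> /PhiP/L2L[].
have PhiD x y : L x -> L y -> Phi (x + y) = Phi x + Phi y.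
  by move=> /PhiP Hx /PhiP Hy; apply: PhiE; exact: (QspanD Hx Hy).
have PhiZ q x : L x -> Phi (ratr q *: x) = ratr q *: Phi x.
  by move=> /PhiP Hx; apply: PhiE; exact: (QspanZ q Hx).
have PhiB x y : L x -> L y -> Phi (br x y) = br (Phi x) (Phi y).
  by move=> /PhiP Hx /PhiP Hy; apply: PhiE; exact: (B2 _ _ Hx Hy).
have Phi_psi x : Gm x -> Phi x = psi x.
  by move=> Gx; apply: PhiE; exact: Qspan_sub.
have Phi_inj x : L x -> Phi x = 0 -> x = 0.
  by move=> /PhiP + E; rewrite E; exact: L2x0.
exists Phi; split=> //; split=> //.
have [d [b [M [Hb HM _]]]] := Qdet_spec span_fin PhiL.
have uM := inj_unitmx PhiD PhiZ Hb HM Phi_inj.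
split=> //.
- move=> x y /set_mem Lx /set_mem Ly E; apply/eqP; rewrite -subr_eq0; apply/eqP.
  have LN : L (- y) by exact: QspanN.
  apply: Phi_inj; first exact: QspanD.
  have := PhiZ (-1) _ Ly; rewrite rmorphN1 !scaleN1r => PN.
  by rewrite PhiD // PN E subrr.
- by move=> y /(unitmx_surj PhiD PhiZ Hb HM uM)[x Lx <-]; exists x.
Qed.

End Extension.

Unset Implicit Arguments.

Theorem theorem1p1 (R : realType) (G : groupType)
  (G_fg : finitely_generated G) (G_tf : torsion_free G)
  (G_nil : nilpotent_group G)
  (n : nat) (N : lieGroup R n) (N_nil : nilpotent_group N)
  (exp : 'rV[R]_n -> N) (log : N -> 'rV[R]_n) (exp_log : is_exp_log exp log)
  (iota : G -> N)
  (iota_morph : {morph iota : x y / (x * y)%g >-> (x * y)%g})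
  (iota_inj : injective iota)
  (iota_discrete : discrete_subset (range iota))
  (iota_cocompact : cocompact (range iota)) :
  let logG : set 'rV[R]_n := log @` range iota in
  let LG : set 'rV[R]_n := Qspan logG in
  co_Hopfian G <->
  (forall Phi : 'rV[R]_n -> 'rV[R]_n,
     Qlie_automorphism (lie_bracket N) LG Phi ->
     Phi @` logG `<=` logG ->
     `|Qdet LG Phi| = 1).
Proof.
move=> logG LG.
have [exp_is expK logK _ _] := exp_log.
have [c [s Hop]] := lie_group_bch exp_log N_nil.
set br := lie_bracket N in Hop *; set op := log_mul exp log in Hop.
pose gam g := log (iota g).
have gamE : logG = range gam.
  apply/seteqP; split=> v; first by move=> [_ [g _ <-] <-]; exists g.
  by move=> [g _ <-]; exists (iota g) => //; exists g.
have gamM x y : gam (x * y)%g = op (gam x) (gam y).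
  by rewrite /gam /op /log_mul !logK iota_morph.
have gam_inj : injective gam by move=> x y /(can_inj logK)/iota_inj.
have gam1 : gam 1%g = 0.
  have := gamM 1%g 1%g; rewrite mulg1 => /(congr1 (op (- gam 1%g))).
  by rewrite (op_Kl Hop) (opNx Hop) => /esym.
have gamV x : gam x^-1%g = - gam x.
  have := gamM x x^-1%g; rewrite mulgV gam1 => /(congr1 (op (- gam x))).
  by rewrite (op_Kl Hop) (op0r Hop) => /esym.
have G0 : logG 0 by rewrite gamE; exists 1%g.
have Gop x y : logG x -> logG y -> logG (op x y).
  by rewrite gamE => -[g _ <-] [h _ <-]; exists (g * h)%g.
have GN x : logG x -> logG (- x).
  by rewrite gamE => -[g _ <-]; exists g^-1%g.
have [gs Hgs] := G_fg; pose gens := [seq gam g | g <- gs].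
have gensG : [set` gens] `<=` logG.
  by move=> _ /mapP[g _ ->]; rewrite gamE; exists g.
have Ggen (M : set 'rV[R]_n) : M 0 -> (forall x, M x -> M (- x)) ->
    (forall x y, M x -> M y -> M (op x y)) -> [set` gens] `<=` M -> logG `<=` M.
  move=> M0 MN Mop Mg; rewrite gamE => _ [g _ <-].
  have : Defs.generated [set` gs] g by rewrite Hgs.
  move=> /(_ [set h | M (gam h)]); apply; last first.
    by move=> h hgs; apply: Mg; exact: map_f.
  split; first by rewrite /= gam1.
  - by move=> x y Mx My; rewrite /= gamM; exact: Mop.
  - by move=> x Mx; rewrite /= gamV; exact: MN.
have span_fin := span_finite Hop G0 Gop GN gensG Ggen.
split=> [coHopf Phi [[PhiL Phi_inj Phi_surj] PhiD PhiZ PhiB] PhiG|detH H [H1 HM HV] [f [fM [fH f_inj f_surj]]]].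
- have PhiL' x : LG x -> LG (Phi x) by exact: PhiL.
  have PhiG' x : logG x -> logG (Phi x) by move=> Gx; apply: PhiG; exists x.
  have [d [b [M [Hb HM ->]]]] := Qdet_spec span_fin PhiL'.
  have GL x : logG x -> LG x by exact: Qspan_sub.
  have PhiGam g : exists h, gam h = Phi (gam g).
    by have : logG (Phi (gam g)); [apply: PhiG'|]; rewrite gamE; [exists g|move=> [h _ <-]; exists h].
  have [f Hf] := choice PhiGam.
  have LGam g : LG (gam g) by apply: GL; rewrite gamE; exists g.
  have fM : {morph f : x y / (x * y)%g >-> (x * y)%g}.
    move=> x y; apply: gam_inj.
    by rewrite gamM !Hf gamM (Phi_op Hop G0 Gop GN PhiD PhiZ PhiB (LGam x) (LGam y)).
  have f_inj : injective f.
    move=> x y /(congr1 gam); rewrite !Hf => E; apply: gam_inj.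
    by apply: Phi_inj => //; apply/mem_set.
  have f1 : f 1%g = 1%g.
    by apply: (mulgI (f 1%g)); rewrite -fM !mulg1.
  have fT : range f = [set: G].
    (* The image of [f] is a subgroup isomorphic to [G]; once it is all of [G], [Phi] maps $\log G$
       onto itself and [det_onto] applies. *)
    apply: coHopf.
      split; first by exists 1%g.
      + by move=> _ _ [x _ <-] [y _ <-]; exists (x * y)%g.
      + move=> _ [x _ <-]; exists x^-1%g => //.
        by apply: (mulgI (f x)); rewrite -fM !mulgV f1.
    exists f; split=> //; split.
    + by move=> x _; exists x.
    + by move=> x y _ _; exact: f_inj.
    + by [].
  apply: (det_onto Hop G0 Gop GN gensG Ggen PhiD PhiZ PhiG' Hb HM).
  move=> y; rewrite gamE => -[g _ <-].
  have [h _ <-] : range f g by rewrite fT.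
  by exists (gam h); [exists h|rewrite Hf].
(* The default value [1%g] is taken outside $\log G$ only, where [psi] is never evaluated. *)
- pose ginv x := xget 1%g [set g | gam g = x].
  have ginvK g : ginv (gam g) = g.
    by apply: gam_inj; exact: (@xgetPex _ 1%g [set h | gam h = gam g] (ex_intro _ g erefl)).
  pose psi x := gam (f (ginv x)).
  have psiE g : psi (gam g) = gam (f g) by rewrite /psi ginvK.
  have psiG x : logG x -> logG (psi x).
    by rewrite gamE => -[g _ <-]; rewrite psiE; exists (f g).
  have psi_op x y : logG x -> logG y -> psi (op x y) = op (psi x) (psi y).
    by rewrite gamE => -[g _ <-] [h _ <-]; rewrite -gamM !psiE fM gamM.
  have psi_inj x y : logG x -> logG y -> psi x = psi y -> x = y.
    rewrite gamE => -[g _ <-] [h _ <-]; rewrite !psiE => /gam_inj E.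
    by congr gam; apply: f_inj => //; exact/mem_set.
  have [Phi [Hphi Phi_psi]] := hom_extension Hop G0 Gop GN span_fin psiG psi_op psi_inj.
  have [[PhiL _ _] PhiD PhiZ PhiB] := Hphi.
  have PhiG' x : logG x -> logG (Phi x) by move=> Gx; rewrite Phi_psi //; exact: psiG.
  have PhiG : Phi @` logG `<=` logG by move=> _ [x Gx <-]; exact: PhiG'.
  have PhiL' x : LG x -> LG (Phi x) by exact: PhiL.
  have := detH Phi Hphi PhiG.
  have [d [b [M [Hb HMx ->]]]] := Qdet_spec span_fin PhiL'.
  move=> /(det_one_onto Hop G0 Gop GN gensG Ggen PhiL' PhiD PhiZ PhiB PhiG' Hb HMx) onto.
  apply/seteqP; split=> // g _.
  have Gg : logG (gam g) by rewrite gamE; exists g.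
  have [x] := onto _ Gg.
  rewrite {1}gamE => -[h _ <-]; rewrite Phi_psi; last by rewrite gamE; exists h.
  rewrite psiE => /gam_inj <-; exact: fH.
Qed.
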